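(* Let $k\in\mathbb{C}\setminus\{0\}$. Every irreducible (grading-restricted) $V_k(\mathfrak{gl}(1|1))$-module has a projective cover in $\mathcal{O}_k^{fin}$.
   Context: **Algebra.** $\mathfrak{gl}(1|1)$ has even basis $N,E$ and odd basis $\psi^+,\psi^-$; nonzero brackets $[N,\psi^\pm]=\pm\psi^\pm$, $\{\psi^+,\psi^-\}=E$; invariant form $\kappa(N,E)=\kappa(E,N)=1$, $\kappa(\psi^+,\psi^-)=-\kappa(\psi^-,\psi^+)=1$, zero on other pairs of basis elements. $\widehat{\mathfrak{gl}(1|1)}=\mathfrak{gl}(1|1)\otimes\mathbb{C}[t,t^{-1}]\oplus\mathbb{C}\mathbf{k}$ with $\mathbf k$ central, $[a_r,b_s]=[a,b]_{r+s}+r\kappa(a,b)\delta_{r+s,0}\mathbf{k}$, $a_r=a\otimes t^r$. $V_k(\mathfrak{gl}(1|1))$ is the level-$k$ module induced from the trivial $\mathfrak{gl}(1|1)$-module, a vertex operator superalgebra with conformal vector $\omega=\frac{1}{2k}(N_{-1}E_{-1}+E_{-1}N_{-1}-\psi^+_{-1}\psi^-_{-1}+\psi^-_{-1}\psi^+_{-1})\mathbf 1+\frac{1}{2k^2}E_{-1}^2\mathbf 1$; $L_n$ are the Virasoro modes. **Category.** $\mathcal{O}_k^{fin}$ is the supercategory of finite-length grading-restricted generalized $V_k(\mathfrak{gl}(1|1))$-modules (direct sums of finite-dimensional generalized $L_0$-eigenspaces, lower-bounded in each coset of $\mathbb Z$) on which $N_0,E_0$ act semisimply. Modules are $\mathbb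 Z_2$-graded; morphisms may be even or odd. All irreducible grading-restricted $V_k(\mathfrak{gl}(1|1))$-modules are objects of $\mathcal{O}_k^{fin}$. **Projective cover.** A projective cover of $S$ is a projective object $P$ with a surjection $\pi:P\to S$ such that for every surjection $q:Q\to S$ with $Q$ projective there is a surjection $\widetilde q:Q\to P$ with $q=\pi\circ\widetilde q$. *)

(* Defs.v *)
From HB Require Import structures.
From mathcomp Require Import all_boot all_order all_algebra.
From mathcomp Require Import classical_sets reals.
From mathcomp.real_closed Require Export complex.
From mathcomp Require Export reals.

Set Implicit Arguments.
Unset Strict Implicit.
Unset Printing Implicit Defensive.

Import GRing.Theory.
Local Open Scope ring_scope.
Local Open Scope classical_set_scope.

(* Everything below is over a field K; it is only meant for K the field of
   complex numbers R[i].  Parities are booleans: false is even, true is odd. *)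

Section LinearAlgebra.
Context (K : fieldType).
Implicit Types W : lmodType K.

Definition subspace W (U : set W) : Prop :=
  U 0 /\ forall (a : K) x y, U x -> U y -> U (a *: x + y).

Definition finite_dimensional W (U : set W) : Prop :=
  exists (n : nat) (e : 'I_n -> W), forall w, U w ->
    exists c : 'I_n -> K, w = \sum_i c i *: e i.

Definition sum_of W (A : set W) : set W :=
  [set w | exists (n : nat) (x : 'I_n -> W),
     (forall i, A (x i)) /\ w = \sum_i x i].

Definition eigenspace_of W (T : W -> W) (h : K) : set W :=
  [set w | T w = h *: w].

Definition gen_eigenspace_of W (T : W -> W) (h : K) : set W :=
  [set w | exists n : nat, iter n (fun x => T x - h *: x) w = 0].

Definition semisimple_operator W (T : W -> W) : Prop :=
  forall w, sum_of [set x | exists h, eigenspace_of T h x] w.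

Record Z2_grading W (par : bool -> set W) : Prop := {
  par_subspace : forall b, subspace (par b);
  par_span : forall w, exists w0 w1,
    [/\ par false w0, par true w1 & w = w0 + w1];
  par_direct : forall w, par false w -> par true w -> w = 0 }.

(* The generalized binomial coefficient m (m-1) ... (m-i+1) / i!. *)
Definition binz (m : int) (i : nat) : K :=
  (\prod_(j < i) (m%:~R - j%:R)) / (i`!)%:R.

Definition sgnp (p q : bool) : K := (-1) ^+ (p && q).

End LinearAlgebra.

Section VertexSuperalgebras.
Context (K : fieldType).

(* A vertex operator is given by its modes: Y v n is the coefficient v_n in
   Y(v,z) = \sum_n v_n z^(-n-1). *)

Section ModuleAxioms.
Variables (V : lmodType K) (parV : bool -> set V) (Y : V -> int -> V -> V).
Variables (vac omega : V) (c : K).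
Variables (W : lmodType K) (parW : bool -> set W) (YW : V -> int -> W -> W).

(* The coefficient of z0^(-l-1) z1^(-m-1) z2^(-n-1) in the
   Jacobi identity
     z0^-1 d((z1-z2)/z0) Y(u,z1)Y(v,z2)
     - (-1)^(|u||v|) z0^-1 d((z2-z1)/(-z0)) Y(v,z2)Y(u,z1)
       = z2^-1 d((z1-z0)/z2) Y(Y(u,z0)v,z2)
   applied to w.  By lower truncation both sums have finitely many nonzero
   terms, so they are the common value of all long enough partial sums. *)
Definition Jacobi_identity : Prop :=
  forall (p q : bool) (u v : V) (w : W) (l m n : int),
  parV p u -> parV q v ->
  exists M : nat, forall M' : nat, (M <= M')%N ->
    \sum_(i < M') binz K m i *: YW (Y u (l + i%:Z) v) (m + n - i%:Z) w =
    \sum_(i < M') ((-1) ^+ i * binz K l i) *: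
       (YW u (l + m - i%:Z) (YW v (n + i%:Z) w)
        - (sgnp K p q * (-1) ^ l) *:
            YW v (l + n - i%:Z) (YW u (m + i%:Z) w)).

Definition Virasoro (n : int) (w : W) : W := YW omega (n + 1) w.

Record module_axioms : Prop := {
  ma_grading : Z2_grading parW;
  ma_linl : forall n w, linear (fun v => YW v n w);
  ma_linr : forall v n, linear (YW v n);
  ma_par : forall p q v n w,
    parV p v -> parW q w -> parW (p (+) q) (YW v n w);
  ma_trunc : forall v w, exists N : int, forall n : int, N <= n -> YW v n w = 0;
  ma_vac : forall n w, YW vac n w = if n == -1 then w else 0;
  ma_Jacobi : Jacobi_identity;
  ma_Virasoro : forall m n w,
    Virasoro m (Virasoro n w) - Virasoro n (Virasoro m w) =
    (m - n)%:~R *: Virasoro (m + n) w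
    + (if m + n == 0 then ((m ^+ 3 - m)%:~R / 12%:R) * c else 0) *: w;
  ma_derivative : forall v n w,
    YW (Y omega 0 v) n w = - (n%:~R *: YW v (n - 1) w) }.

End ModuleAxioms.

(* Conformal weights are allowed to be half-integers, independently of the
   parity. *)
Record vosa := Vosa {
  vcar :> lmodType K;
  vpar : bool -> set vcar;
  vY : vcar -> int -> vcar -> vcar;
  vvac : vcar;
  vomega : vcar;
  vcharge : K;
  v_adjoint : module_axioms vpar vY vvac vomega vcharge vpar vY;
  v_creation : forall v (n : int), 0 <= n -> vY v n vvac = 0;
  v_state : forall v, vY v (-1) vvac = v;
  v_vac_even : vpar false vvac;
  v_omega_even : vpar false vomega;
  v_weights : forall v, sum_of
    [set x | exists n : int, eigenspace_of (vY vomega 1) (n%:~R / 2%:R) x] v;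
  v_findim : forall n : int,
    finite_dimensional (eigenspace_of (vY vomega 1) (n%:~R / 2%:R));
  v_lower : exists N : int, forall n : int, n < N ->
    forall v, eigenspace_of (vY vomega 1) (n%:~R / 2%:R) v -> v = 0;
  v_wt_vac : eigenspace_of (vY vomega 1) 0 vvac;
  v_wt_omega : eigenspace_of (vY vomega 1) 2%:R vomega }.

Record vmodule (V : vosa) := VModule {
  mcar :> lmodType K;
  mpar : bool -> set mcar;
  mY : V -> int -> mcar -> mcar;
  m_axioms : module_axioms (@vpar V) (@vY V) (vvac V) (vomega V) (vcharge V)
               mpar mY }.

Section Modules.
Variable V : vosa.
Implicit Types W A B S P Q : vmodule V.

Definition Lzero W : W -> W := Virasoro (vomega V) (@mY V W) 0.

Record grading_restricted W : Prop := {
  gr_sum : forall w, sum_of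
    [set x | exists h, gen_eigenspace_of (@Lzero W) h x] w;
  gr_findim : forall h, finite_dimensional (gen_eigenspace_of (@Lzero W) h);
  gr_lower : forall h : K, exists N : nat, forall n : nat, (N <= n)%N ->
    forall w, gen_eigenspace_of (@Lzero W) (h - n%:R) w -> w = 0 }.

Record submodule W (U : set W) : Prop := {
  sub_space : subspace U;
  sub_stable : forall v n w, U w -> U (mY v n w);
  sub_graded : forall w0 w1,
    mpar false w0 -> mpar true w1 -> U (w0 + w1) -> U w0 /\ U w1 }.

Definition irreducible W : Prop :=
  (exists w : W, w <> 0) /\
  forall U : set W, submodule U -> U = [set 0] \/ U = setT.

(* U i.+1 / U i is irreducible: by the correspondence theorem its submodules
   are the submodules between U i and U i.+1. *)
Definition finite_length W : Prop :=
  exists (n : nat) (U : nat -> set W),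
  [/\ U 0%N = [set 0], U n = setT, (forall i, (i <= n)%N -> submodule (U i)) &
    forall i, (i < n)%N ->
      [/\ U i `<=` U i.+1, U i <> U i.+1 &
        forall X, submodule X -> U i `<=` X -> X `<=` U i.+1 ->
          X = U i \/ X = U i.+1]].

Definition hom_of_parity (b : bool) A B (f : A -> B) : Prop :=
  [/\ linear f,
      (forall q a, mpar q a -> mpar (b (+) q) (f a)) &
      forall p v n a, vpar p v -> f (mY v n a) = sgnp K b p *: mY v n (f a)].

(* Morphisms are even or odd. *)
Definition hom A B (f : A -> B) : Prop := exists b, hom_of_parity b f.

Definition surjection A B (f : A -> B) : Prop :=
  hom f /\ forall y, exists x, f x = y.

(* A full subcategory is given by its class of objects O. *)
Section Projectives.
Variable O : vmodule V -> Prop.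

Definition projective P : Prop :=
  O P /\
  forall A B (q : A -> B) (f : P -> B),
    O A -> O B -> surjection q -> hom f ->
    exists g : P -> A, hom g /\ forall x, f x = q (g x).

Definition projective_cover S P (pi : P -> S) : Prop :=
  [/\ projective P, surjection pi &
    forall Q (q : Q -> S), projective Q -> surjection q ->
      exists q' : Q -> P, surjection q' /\ forall x, q x = pi (q' x)].

End Projectives.
End Modules.
End VertexSuperalgebras.

Inductive gl11 := gN | gE | gPsip | gPsim.

Definition gl11_par (a : gl11) : bool :=
  match a with gN | gE => false | gPsip | gPsim => true end.

Section Gl11.
Context (K : fieldType).

(* The superbracket is [a, b] = \sum_c gl11_bracket a b c *: c. *)
Definition gl11_bracket (a b c : gl11) : K :=
  match a, b, c with
  | gN, gPsip, gPsip => 1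
  | gPsip, gN, gPsip => -1
  | gN, gPsim, gPsim => -1
  | gPsim, gN, gPsim => 1
  | gPsip, gPsim, gE => 1
  | gPsim, gPsip, gE => 1
  | _, _, _ => 0
  end.

Definition gl11_form (a b : gl11) : K :=
  match a, b with
  | gN, gE | gE, gN => 1
  | gPsip, gPsim => 1
  | gPsim, gPsip => -1
  | _, _ => 0
  end.

(* Representations of the affine Lie superalgebra on which the central
   element acts by k; act a r is the action of a_r = a (x) t^r. *)
Record affine_rep (k : K) (M : lmodType K) (par : bool -> set M)
    (act : gl11 -> int -> M -> M) : Prop := {
  ar_grading : Z2_grading par;
  ar_linear : forall a r, linear (act a r);
  ar_par : forall a r q w, par q w -> par (gl11_par a (+) q) (act a r w);
  ar_bracket : forall a b r s w,
    act a r (act b s w)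
    - sgnp K (gl11_par a) (gl11_par b) *: act b s (act a r w) =
    \sum_(c <- [:: gN; gE; gPsip; gPsim])
       gl11_bracket a b c *: act c (r + s) w
    + (if r + s == 0 then r%:~R * gl11_form a b * k else 0) *: w }.

(* Universal property of the module induced from the trivial gl(1|1)-module,
   on which a_r acts by 0 for r >= 0 and the central element by k. *)
Definition induced_from_trivial (k : K) (V : lmodType K)
    (par : bool -> set V) (act : gl11 -> int -> V -> V) (vac : V) : Prop :=
  [/\ affine_rep k par act, par false vac,
      (forall a (r : int), 0 <= r -> act a r vac = 0) &
      forall (M : lmodType K) (parM : bool -> set M)
             (actM : gl11 -> int -> M -> M) (m : M),
        affine_rep k parM actM -> parM false m ->
        (forall a (r : int), 0 <= r -> actM a r m = 0) ->
        exists! f : V -> M,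
          [/\ linear f, (forall q v, par q v -> parM q (f v)),
              (forall a r v, f (act a r v) = actM a r (f v)) &
              f vac = m]].

(* The vertex operator superalgebra V_k(gl(1|1)), determined up to unique
   isomorphism: gen a is the state a_(-1) 1 whose modes gen a_(n) are the a_n. *)
Record Vk_gl11 (k : K) := VkGl11 {
  Vk_vosa :> vosa K;
  Vk_gen : gl11 -> Vk_vosa;
  Vk_induced : induced_from_trivial k (@vpar K Vk_vosa)
    (fun a n => vY (Vk_gen a) n) (vvac Vk_vosa);
  Vk_omega :
    let a_ (a : gl11) (v : Vk_vosa) := vY (Vk_gen a) (-1) v in
    let one := vvac Vk_vosa in
    vomega Vk_vosa =
      (2%:R * k)^-1 *:
        (a_ gN (a_ gE one) + a_ gE (a_ gN one)
         - a_ gPsip (a_ gPsim one) + a_ gPsim (a_ gPsip one))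
      + (2%:R * k ^+ 2)^-1 *: a_ gE (a_ gE one) }.

Record Okfin (k : K) (V : Vk_gl11 k) (W : vmodule V) : Prop := {
  ok_length : finite_length W;
  ok_graded : grading_restricted W;
  ok_N : semisimple_operator (mY (v := W) (Vk_gen V gN) 0);
  ok_E : semisimple_operator (mY (v := W) (Vk_gen V gE) 0) }.

End Gl11.

(* Main.v *)
Require Import Defs.
From HB Require Import structures.
From mathcomp Require Import all_boot all_order all_algebra.
From mathcomp Require Import ring lra zify.
From mathcomp Require Import boolp classical_sets reals.

(* The projective cover of S is obtained, without constructing it explicitly, as a
   module of maximal length among the local modules with head S.

   Lengths are bounded because of the following grading.  Let E_0 = e on S (and hence
   on a local module with head S), x = e/k and l = floor (Re x).  Every nonzero
   subquotient contains a vector killed by N_r, E_r (r > 0), psi^+_r (r >= -l) and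
   psi^-_r (r > l), and by the Sugawara formula D = L_0 - x N_0 acts on it by a
   constant d0 depending only on e.  The remaining modes never lower Re D, and all
   of them except N_0, E_0 and psi^-_l raise it strictly.  Hence the generalized
   d0-eigenspace of D in the module generated by one of its elements y is spanned by
   y, psi^+_(-l) y, psi^-_l y and psi^-_l psi^+_(-l) y, while each step of a chain of
   submodules contributes to this eigenspace: all chains have length at most 4.

   If P is local of maximal length, q : A -> B is surjective and f : P -> B, choose a
   local submodule Z with head S in the fibre product of P and A over B.  It maps onto
   P, injectively by maximality, so it is the graph of a lift of f.  A map from a
   projective module to P lifting a surjection to S is surjective by locality. *)

Set Implicit Arguments.
Unset Strict Implicit.
Unset Printing Implicit Defensive.
Import Order.TTheory GRing.Theory Num.Theory.
Local Open Scope ring_scope.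
Local Open Scope classical_set_scope.

(** * Linear algebra *)

(** [L_0] alone does not bound lengths: composition factors may have different lowest [L_0]-weights,
    so no single weight space sees every step of a chain. Subtracting [x N_0] gives all subquotients
    with [E_0 = e] the same lowest degree [d0]. The price is that the index of a mode no longer
    decides whether it raises or lowers: [psi^+_r] and [psi^-_r] change [D] by [-(r + x)] and
    [-(r - x)]. The condition [l <= Re x < l + 1] is what makes every annihilator have a nonnegative
    drop of [Re D]; real parts appear because [x] is complex. The fermionic modes whose drop may
    vanish are [psi^+_(-l)] and [psi^-_l], with drops [Re x - l] and [l - Re x]. Each squares to
    zero, which leaves 2 x 2 words and explains the constant 4. Integral and nonintegral [x]
    (atypical and typical S) are treated together, so 4 is only an upper bound.

    Local modules are compared inside the class [admissible], stable under products, submodules and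
    parity shifts; finite length of P comes at the end, since a chain of maximal length is a
    composition series. Odd morphisms are absorbed by a parity shift before the fibre product is
    formed. *)

Section ModuleNormalForm.
Context (K : fieldType) (W : lmodType K).

Inductive mexpr := MVar of nat | MZero | MAdd of mexpr & mexpr | MOpp of mexpr
  | MScale of K & mexpr.

Fixpoint meval (env : seq W) (e : mexpr) : W :=
  match e with
  | MVar i => env`_i
  | MZero => 0
  | MAdd e1 e2 => meval env e1 + meval env e2
  | MOpp e1 => - meval env e1
  | MScale a e1 => a *: meval env e1
  end.

Fixpoint mcoef (e : mexpr) (i : nat) : K :=
  match e with
  | MVar j => if eqn i j then 1 else 0
  | MZero => 0
  | MAdd e1 e2 => mcoef e1 i + mcoef e2 i
  | MOpp e1 => - mcoef e1 i
  | MScale a e1 => a * mcoef e1 i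
  end.

(** Recursive rather than quantified over indices, so that [cbn] turns it into one scalar goal per
    atom, ready for [ring]. *)
Fixpoint mcoef_eq (n : nat) (e1 e2 : mexpr) : Prop :=
  if n is n'.+1 then mcoef e1 n' = mcoef e2 n' /\ mcoef_eq n' e1 e2 else True.

Lemma mevalE env e : meval env e = \sum_(i < size env) mcoef e i *: env`_i.
Proof.
elim: e => [j||e1 IH1 e2 IH2|e1 IH1|a e1 IH1] /=.
- have [jlt|jge] := ltnP j (size env).
    rewrite (bigD1 (Ordinal jlt)) //= (eqxx j : eqn j j) scale1r big1 ?addr0 // => i.
    by rewrite -val_eqE /= => /negPf ij; rewrite -[eqn _ _]/(_ == _) ij scale0r.
  rewrite nth_default // big1 // => i _; rewrite -[eqn _ _]/(_ == _) ltn_eqF ?scale0r //.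
  exact: leq_trans (ltn_ord i) jge.
- by rewrite big1 // => i _; rewrite scale0r.
- by rewrite IH1 IH2 -big_split; apply: eq_bigr => i _; rewrite scalerDl.
- by rewrite IH1 -sumrN; apply: eq_bigr => i _; rewrite scaleNr.
- by rewrite IH1 scaler_sumr; apply: eq_bigr => i _; rewrite scalerA.
Qed.

Lemma meval_eq env e1 e2 :
  mcoef_eq (size env) e1 e2 -> meval env e1 = meval env e2.
Proof.
rewrite !mevalE; elim: (size env) => [|n IHn] /=; first by rewrite !big_ord0.
by case=> E /IHn En; rewrite !big_ord_recr /= En E.
Qed.

End ModuleNormalForm.

Ltac lm_find x env :=
  lazymatch env with
  | x :: _ => constr:(0%N)
  | _ :: ?env' => let n := lm_find x env' in constr:(S n)
  end.

Ltac lm_atoms t env :=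
  lazymatch t with
  | (?a + ?b)%R => let env1 := lm_atoms a env in lm_atoms b env1
  | (- ?a)%R => lm_atoms a env
  | (_ *: ?a)%R => lm_atoms a env
  | 0%R => env
  | _ => match env with
         | _ => let _ := lm_find t env in env
         | _ => constr:(t :: env)
         end
  end.

Ltac lm_quote K t env :=
  lazymatch t with
  | (?a + ?b)%R => let a' := lm_quote K a env in let b' := lm_quote K b env in
                 constr:(@MAdd K a' b')
  | (- ?a)%R => let a' := lm_quote K a env in constr:(@MOpp K a')
  | (?c *: ?a)%R => let a' := lm_quote K a env in constr:(@MScale K c a')
  | 0%R => constr:(@MZero K)
  | _ => let n := lm_find t env in constr:(@MVar K n)
  end.

(* Decides linear identities in a module, up to ring identities between the
   coefficients of each atom; these are left to the user if ring fails. *)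
Ltac lmod_eq F :=
  lazymatch goal with
  | |- @eq ?T ?a ?b =>
    let K := constr:(F : fieldType) in
    let K := eval cbv beta in K in
    let env0 := lm_atoms a (@nil T) in
    let env := lm_atoms b env0 in
    let ea := lm_quote K a env in
    let eb := lm_quote K b env in
    refine (@meval_eq K _ env ea eb _);
    cbn [mcoef_eq mcoef size eqn]; repeat split; try ring
  end.

Section LinearMaps.
Context (K : fieldType) (U W : lmodType K) (f : U -> W) (f_lin : linear f).

Lemma lin_add x y : f (x + y) = f x + f y.
Proof. by rewrite -[x in LHS]scale1r f_lin scale1r. Qed.

Lemma lin_zero : f 0 = 0.
Proof. by apply: (@addrI _ (f 0)); rewrite -lin_add !addr0. Qed.

Lemma lin_scale a x : f (a *: x) = a *: f x.
Proof. by rewrite -[a *: x]addr0 f_lin lin_zero addr0. Qed.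

Lemma lin_opp x : f (- x) = - f x.
Proof. by rewrite -scaleN1r lin_scale scaleN1r. Qed.

Lemma lin_sub x y : f (x - y) = f x - f y.
Proof. by rewrite lin_add lin_opp. Qed.

Lemma lin_sum I (r : seq I) (P : pred I) (F : I -> U) :
  f (\sum_(i <- r | P i) F i) = \sum_(i <- r | P i) f (F i).
Proof. exact: (big_morph f lin_add lin_zero). Qed.

End LinearMaps.

Section Subspaces.
Context (K : fieldType) (W : lmodType K).
Implicit Types (U : set W) (T : W -> W) (h : K).

Section Closure.
Context (U : set W) (Usub : subspace U).

Lemma sub0 : U 0. Proof. by case: Usub. Qed.

Lemma subD x y : U x -> U y -> U (x + y).
Proof. by move=> Ux Uy; rewrite -[x]scale1r; apply: Usub.2. Qed.

Lemma subZ a x : U x -> U (a *: x).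
Proof. by move=> Ux; rewrite -[_ *: _]addr0; apply: Usub.2 => //; apply: sub0. Qed.

Lemma subN x : U x -> U (- x).
Proof. by rewrite -scaleN1r; apply: subZ. Qed.

Lemma subB x y : U x -> U y -> U (x - y).
Proof. by move=> Ux Uy; apply: subD => //; apply: subN. Qed.

Lemma sub_sum I (r : seq I) (P : pred I) (F : I -> W) :
  (forall i, P i -> U (F i)) -> U (\sum_(i <- r | P i) F i).
Proof. by move=> H; elim/big_ind: _ => //; [apply: sub0 | apply: subD]. Qed.

Lemma subDl x y : U x -> U (x + y) -> U y.
Proof. by move=> Ux Uxy; rewrite -(addKr x y) addrC; apply: subB. Qed.

End Closure.

Lemma subspace_zero : subspace [set (0 : W)].
Proof. by split=> //= a x y -> ->; rewrite scaler0 addr0. Qed.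

Lemma subspaceI U U' : subspace U -> subspace U' -> subspace (U `&` U').
Proof.
move=> [U0 Ul] [U'0 U'l]; split=> // a x y [? ?] [? ?].
by split; [apply: Ul | apply: U'l].
Qed.

Lemma subspace_preim (W' : lmodType K) (f : W -> W') (U' : set W') :
  linear f -> subspace U' -> subspace [set x | U' (f x)].
Proof.
move=> fl [U'0 U'l]; split=> [|a x y] /=; first by rewrite lin_zero.
by rewrite fl; apply: U'l.
Qed.

Lemma sum_of_subspace (A : set W) :
  (forall a x, A x -> A (a *: x)) -> subspace (sum_of A).
Proof.
move=> AZ; split=> [|a _ _ [n [x [Ax ->]]] [m [y [Ay ->]]]].
  by exists 0%N, (fun=> 0); split=> [[]|] //; rewrite big_ord0.
exists (n + m)%N, (fun i => match split i with inl j => a *: x j | inr j => y j end).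
split=> [i|]; first by case: (split i) => j; [apply: AZ; apply: Ax | apply: Ay].
rewrite big_split_ord /= scaler_sumr; congr (_ + _); apply: eq_bigr => i _.
  by rewrite (unsplitK (inl i)).
by rewrite (unsplitK (inr i)).
Qed.

Lemma sum_of_incl (A : set W) x : A x -> sum_of A x.
Proof. by move=> Ax; exists 1%N, (fun=> x); rewrite big_ord1. Qed.

Lemma sum_of_least (A U : set W) : subspace U -> A `<=` U -> sum_of A `<=` U.
Proof. by move=> sU AU _ [n [x [Ax ->]]]; apply: sub_sum => // i _; apply: AU. Qed.

Lemma sum_of_mono (A B : set W) : A `<=` B -> sum_of A `<=` sum_of B.
Proof. by move=> AB _ [n [x [Ax ->]]]; exists n, x; split=> // i; apply: AB. Qed.

End Subspaces.

Section GeneralizedEigenvectors.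
Context (K : fieldType) (W : lmodType K) (T : W -> W) (T_lin : linear T).
Implicit Types (U : set W) (h : K).

Let shift h := fun x => T x - h *: x.

Lemma shift_lin h : linear (shift h).
Proof. by move=> a x y; rewrite /shift T_lin; lmod_eq K. Qed.

Lemma iter_shift_lin h n : linear (iter n (shift h)).
Proof. by elim: n => [|n IHn] a x y //=; rewrite IHn shift_lin. Qed.

Lemma gen_iter_le h n m w : (n <= m)%N ->
  iter n (shift h) w = 0 -> iter m (shift h) w = 0.
Proof.
by move=> /subnK <- E; rewrite iterD E lin_zero //; apply: iter_shift_lin.
Qed.

Lemma gen_subspace h : subspace (gen_eigenspace_of T h).
Proof.
split=> [|a x y [n nx] [m my]]; first by exists 0%N.
exists (maxn n m); rewrite (iter_shift_lin h) (gen_iter_le (leq_maxl n m) nx).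
by rewrite (gen_iter_le (leq_maxr n m) my) scaler0 addr0.
Qed.

Lemma eigen_gen h w : eigenspace_of T h w -> gen_eigenspace_of T h w.
Proof. by rewrite /eigenspace_of /= => E; exists 1%N; rewrite /= E subrr. Qed.

Lemma eigen_subspace h : subspace (eigenspace_of T h).
Proof.
rewrite /eigenspace_of; split=> [|a x y] /=; first by rewrite scaler0 lin_zero.
by move=> Ex Ey; rewrite T_lin Ex Ey; lmod_eq K.
Qed.

(** Induction on the nilpotency order of [T - h] at [x]: the vector [(T - h) x] has smaller order
    and lies in [U] by induction, and [(h - h') x] is the difference of [(T - h') x] and
    [(T - h) x]. *)
Lemma gen_shift_inj U h h' x : subspace U -> (forall y, U y -> U (T y)) ->
  gen_eigenspace_of T h x -> h <> h' -> U (T x - h' *: x) -> U x.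
Proof.
move=> sU UT [n]; elim: n x => [|n IHn] x; first by move=> /= -> *; apply: sub0.
rewrite iterSr => nx hh' Ux.
have Usx : U (T x - h *: x).
  apply: IHn => //; rewrite (lin_sub T_lin) (lin_scale T_lin).
  set Tx := T x in Ux *; set TTx := T Tx.
  have -> : TTx - h *: Tx - h' *: (Tx - h *: x) = T (Tx - h' *: x) - h *: (Tx - h' *: x).
    by rewrite (lin_sub T_lin) (lin_scale T_lin) -/TTx -/Tx; lmod_eq K.
  by apply: (subB sU); [apply: UT | apply: subZ].
have h0 : h - h' != 0 by rewrite subr_eq0; apply/eqP.
have -> : x = (h - h')^-1 *: ((T x - h' *: x) - (T x - h *: x)).
  have {1}-> : x = ((h - h')^-1 * (h - h')) *: x by rewrite mulVf ?scale1r.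
  by lmod_eq K.
by apply: (subZ sU); apply: (subB sU).
Qed.

Lemma gen_iter_inj U h h' x n : subspace U -> (forall y, U y -> U (T y)) ->
  gen_eigenspace_of T h x -> h <> h' -> U (iter n (shift h') x) -> U x.
Proof.
move=> sU UT; elim: n x => [//|n IHn] x gx hh' /=; rewrite -iterS iterSr => Ux.
apply: (gen_shift_inj sU UT gx hh'); apply: IHn => //.
case: gx => m mx; exists m.
suff -> : forall y, iter m (shift h) (shift h' y) = shift h' (iter m (shift h) y).
  by rewrite mx /shift lin_zero // scaler0 subr0.
elim: (m) => [//|m' IH] y; rewrite iterSr [in RHS]iterSr -IH; congr (iter _ _ _).
by rewrite /shift !(lin_sub T_lin) !(lin_scale T_lin); lmod_eq K.
Qed.

(** A power of [T - h0] kills the [h0]-component and acts injectively modulo [U] on the others, so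
    induction on the list of eigenvalues applies. *)
Lemma gen_components U (hs : seq K) (x : K -> W) : subspace U ->
  (forall y, U y -> U (T y)) -> uniq hs ->
  (forall h, gen_eigenspace_of T h (x h)) ->
  U (\sum_(h <- hs) x h) -> forall h, h \in hs -> U (x h).
Proof.
move=> sU UT; elim: hs x => [//|h0 hs IH] x /= /andP[h0hs uhs] gx.
rewrite big_cons => Ux.
have [n nx] := gx h0.
have Uit y : U y -> U (iter n (shift h0) y).
  by move=> Uy; elim: (n) => [//|m Um]; apply: (subB sU); [apply: UT|apply: subZ].
have Uhs h : h \in hs -> U (x h).
  move=> hin; have hh0 : h <> h0 by move=> E; rewrite -E hin in h0hs.
  apply: (gen_iter_inj (n := n) sU UT (gx h) hh0).
  apply: (IH (fun h => iter n (shift h0) (x h))) => //.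
    move=> h1; have [m mx] := gx h1; exists m.
    elim: (n) => [//|n' IHn] /=.
    have -> : forall y, iter m (shift h1) (shift h0 y) = shift h0 (iter m (shift h1) y).
      elim: (m) => [//|m' IHm] y; rewrite iterSr [in RHS]iterSr -IHm; congr (iter _ _ _).
      by rewrite /shift !(lin_sub T_lin) !(lin_scale T_lin); lmod_eq K.
    by rewrite IHn /shift lin_zero // scaler0 subr0.
  by have := Uit _ Ux; rewrite (lin_add (iter_shift_lin h0 n)) nx add0r (lin_sum (iter_shift_lin h0 n)).
move=> h; rewrite inE => /orP[/eqP ->|/Uhs //].
move: Ux; rewrite addrC; apply: subDl => //; rewrite big_seq.
by apply: sub_sum.
Qed.

Section Decomposition.
(* E h is to be either the eigenspace or the generalized eigenspace. *)
Context (E : K -> set W) (E_sub : forall h, subspace (E h))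
  (E_gen : forall h, E h `<=` gen_eigenspace_of T h).

Lemma collect_eigenvectors w : sum_of [set x | exists h, E h x] w ->
  exists (hs : seq K) (x : K -> W),
    [/\ uniq hs, forall h, E h (x h) & w = \sum_(h <- hs) x h].
Proof.
move=> [n [x [/= Ex ->]]].
have [e ex] := fin_all_exists Ex.
exists (undup (map e (enum 'I_n))), (fun h => \sum_(i < n | e i == h) x i).
split; first exact: undup_uniq.
- by move=> h; apply: sub_sum => // i /eqP <-.
- rewrite (exchange_big_dep predT) //=; apply: eq_bigr => i _.
  rewrite -big_filter.
  have -> : [seq h <- undup (map e (enum 'I_n)) | e i == h] = [:: e i].
    rewrite (eq_filter (a2 := pred1 (e i))); last by move=> h; rewrite /= eq_sym.
    rewrite filter_pred1_uniq ?undup_uniq // mem_undup.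
    by apply: map_f; rewrite mem_enum.
  by rewrite big_seq1.
Qed.

Lemma sum_of_eigen_sub U w : subspace U -> (forall y, U y -> U (T y)) -> U w ->
  sum_of [set x | exists h, E h x] w ->
  sum_of [set x | U x /\ exists h, E h x] w.
Proof.
move=> sU UT Uw /collect_eigenvectors [hs [x [uhs Ex Ew]]].
rewrite {}Ew in Uw *.
have Ux := gen_components sU UT uhs (fun h => E_gen (Ex h)) Uw.
rewrite big_seq.
apply: sub_sum => [|h /Ux Uxh]; last by apply: sum_of_incl; split=> //; exists h.
apply: sum_of_subspace => a y [Uy [h Ey]]; split; first exact: subZ.
by exists h; apply: (subZ (E_sub h)).
Qed.

End Decomposition.

Lemma gen_project h0 v n (w : 'I_n -> W) (e : 'I_n -> K) :
  gen_eigenspace_of T h0 v -> (forall i, gen_eigenspace_of T (e i) (w i)) ->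
  v = \sum_i w i -> v = \sum_(i | e i == h0) w i.
Proof.
move=> gv gw Ev.
pose hs := undup (h0 :: map e (enum 'I_n)).
(* The discrepancy between [v], placed at [h0], and the grouped [w i]. These vectors sum to zero, so
   [gen_components] with [U = 0] makes each of them vanish. *)
pose x h := \sum_(i < n | e i == h) w i - (if h == h0 then v else 0).
have gx h : gen_eigenspace_of T h (x h).
  apply: (subB (gen_subspace h)).
    by apply: sub_sum => [|i /eqP <-//]; apply: gen_subspace.
  by case: eqP => [->//|_]; apply: sub0; apply: gen_subspace.
have h0hs : h0 \in hs by rewrite mem_undup inE eqxx.
have Ex : \sum_(h <- hs) x h = 0.
  rewrite sumrB -big_mkcond -big_filter /=.
  rewrite filter_pred1_uniq ?undup_uniq // big_seq1 (exchange_big_dep predT) //=.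
  apply/eqP; rewrite subr_eq0 {1}Ev; apply/eqP; apply: eq_bigr => i _.
  rewrite -big_filter.
  have -> : [seq h <- hs | e i == h] = [:: e i].
    rewrite (eq_filter (a2 := pred1 (e i))); last by move=> h; rewrite /= eq_sym.
    rewrite filter_pred1_uniq ?undup_uniq // mem_undup inE.
    by rewrite map_f ?orbT // mem_enum.
  by rewrite big_seq1.
have /= := gen_components (subspace_zero W) _ (undup_uniq _) gx Ex h0hs.
rewrite /x eqxx => H; apply/esym/eqP; rewrite -subr_eq0; apply/eqP/H.
by move=> y /= ->; apply: lin_zero.
Qed.

End GeneralizedEigenvectors.

Lemma gen_eigen_map (K : fieldType) (W W' : lmodType K) (T : W -> W)
    (T' : W' -> W') (f : W -> W') (s h : K) w : linear f ->
  (forall x, T' (f x) = f (T x) + s *: f x) ->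
  gen_eigenspace_of T h w -> gen_eigenspace_of T' (h + s) (f w).
Proof.
move=> fl fT [n nw]; exists n.
suff -> : forall x, iter n (fun x => T' x - (h + s) *: x) (f x) =
            f (iter n (fun x => T x - h *: x) x) by rewrite nw lin_zero.
elim: (n) => [//|m IH] x; rewrite [in RHS]iterSr -IH iterSr; congr (iter _ _ _).
by rewrite fT (lin_sub fl) (lin_scale fl); lmod_eq K.
Qed.

Section CommutingOperators.
Context (K : fieldType) (W : lmodType K) (L N : W -> W) (L_lin : linear L)
  (N_lin : linear N) (LN : forall w, L (N w) = N (L w)).

Lemma gen_joint (x h n : K) v : gen_eigenspace_of L h v -> N v = n *: v ->
  gen_eigenspace_of (fun w => L w - x *: N w) (h - x * n) v.
Proof.
move=> [m mv] Nv; exists m; rewrite -mv; elim: m v Nv {mv} => [//|m IH] v Nv.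
rewrite !iterSr Nv.
have -> : L v - x *: (n *: v) - (h - x * n) *: v = L v - h *: v by lmod_eq K.
by apply: IH; rewrite (lin_sub N_lin) (lin_scale N_lin) -LN Nv (lin_scale L_lin); lmod_eq K.
Qed.

End CommutingOperators.

Section FiniteDimension.
Context (K : fieldType) (W : lmodType K).

(** [finite_dimensional] allows spanning vectors outside the subspace, whereas restricting to a
    submodule needs them inside. Elimination: treat the part of [X] in the span of all but the last
    vector, then add one [z] in [X] with nonzero last coordinate, if there is any. *)
Lemma finite_dimensional_sub (U X : set W) : finite_dimensional U ->
  subspace X -> X `<=` U ->
  exists n (e : 'I_n -> W), (forall i, X (e i)) /\
    forall w, X w -> exists c : 'I_n -> K, w = \sum_i c i *: e i.
Proof.
move=> [n [e eU]] sX XU.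
have {U XU eU} : forall w, X w -> exists c : 'I_n -> K, w = \sum_i c i *: e i.
  by move=> w /XU /eU.
elim: n e X sX => [|n IH] e X sX Xe.
  exists 0%N, e; split=> [[]//|w /Xe [c]]; rewrite big_ord0 => ->.
  by exists c; rewrite big_ord0.
pose f i := e (lift ord_max i).
pose X' := X `&` [set w | exists c : 'I_n -> K, w = \sum_i c i *: f i].
have sX' : subspace X'.
  split=> [|a x y [Xx [c Ex]] [Xy [d Ey]]].
    by split; [apply: sub0|exists (fun=> 0); rewrite big1 // => i _; rewrite scale0r].
  split; first exact: sX.2.
  exists (fun i => a * c i + d i); rewrite Ex Ey scaler_sumr -big_split.
  by apply: eq_bigr => i _; rewrite scalerDl scalerA.
have [m [g [gX' Xg]]] := IH f X' sX' (fun w Xw => Xw.2).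
have recE (c : 'I_n.+1 -> K) : \sum_i c i *: e i =
    \sum_i c (lift ord_max i) *: f i + c ord_max *: e ord_max.
  rewrite big_ord_recr /=; congr (_ + _); apply: eq_bigr => i _.
  by rewrite /f; congr (c _ *: e _); apply: val_inj => /=; rewrite /bump leqNgt ltn_ord.
have [[z [c [Xz Ez cn]]]|noz] := pselect (exists z (c : 'I_n.+1 -> K),
    [/\ X z, z = \sum_i c i *: e i & c ord_max != 0]); last first.
  exists m, g; split=> [i|w Xw]; first by case: (gX' i).
  apply: Xg; split=> //; have [c Ec] := Xe w Xw.
  exists (fun i => c (lift ord_max i)); rewrite Ec recE.
  have [->|cn] := eqVneq (c ord_max) 0; first by rewrite scale0r addr0.
  by case: noz; exists w, c.
exists m.+1, (fun i => if unlift ord_max i is Some j then g j else z).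
split=> [i|w Xw]; first by case: unliftP => // j _; case: (gX' j).
have [d Ed] := Xe w Xw.
pose a := d ord_max / c ord_max.
have : X' (w - a *: z).
  split; first by apply: (subB sX) => //; apply: (subZ sX).
  exists (fun i => d (lift ord_max i) - a * c (lift ord_max i)).
  rewrite Ed Ez !recE scalerDr scalerA /a divfK //.
  set F := \sum_i d (lift _ _) *: _; set G := \sum_i c (lift _ _) *: _.
  transitivity (F - a *: G); first by rewrite /a; lmod_eq K.
  by rewrite /F /G scaler_sumr -sumrB; apply: eq_bigr => i _; rewrite /a; lmod_eq K.
move=> /Xg [b Eb].
exists (fun i => if unlift ord_max i is Some j then b j else a).
rewrite big_ord_recr /= unlift_none -[w](subrK (a *: z)) Eb; congr (_ + _).
apply: eq_bigr => i _.
have -> : widen_ord (leqnSn m) i = lift ord_max i.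
  by apply: val_inj => /=; rewrite /bump leqNgt ltn_ord.
by rewrite liftK.
Qed.

Lemma dependent_vectors m n (t : 'I_m -> W) (v : 'I_n -> W) : (m < n)%N ->
  (forall i, exists c : 'I_m -> K, v i = \sum_j c j *: t j) ->
  exists2 a : 'I_n -> K, exists i, a i != 0 & \sum_i a i *: v i = 0.
Proof.
move=> mn /fin_all_exists [c vc].
pose A := \matrix_(i, j) c i j.
have kA : kermx A != 0.
  by rewrite -mxrank_eq0 mxrank_ker subn_eq0 -ltnNge (leq_ltn_trans (rank_leq_col _)).
have [i0 Ai0] : exists i, row i (kermx A) != 0.
  by apply/existsP; apply: contraNT kA => /existsPn H; apply/eqP/row_matrixP => i;
     rewrite row0; apply/eqP; move: (H i); rewrite negbK.
exists (row i0 (kermx A) 0).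
  apply/existsP; apply: contraNT Ai0 => /existsPn H; apply/eqP/rowP => j.
  by rewrite mxE [in RHS]mxE; apply/eqP; move: (H j); rewrite negbK mxE.
have : row i0 (kermx A) *m A = 0 by rewrite -row_mul mulmx_ker row0.
move: (row i0 _) => r rA.
transitivity (\sum_j (r *m A) 0 j *: t j); last first.
  by rewrite rA big1 // => j _; rewrite mxE scale0r.
under [in RHS]eq_bigr do rewrite mxE scaler_suml.
rewrite [RHS]exchange_big; apply: eq_bigr => i _; rewrite vc scaler_sumr.
by apply: eq_bigr => j _; rewrite mxE scalerA.
Qed.

End FiniteDimension.

(** The iterates of [T] on [w] are dependent, so [p(T) w = 0] for some nonzero [p] ([ev p v] is
    [p(T) v]). Peeling off the linear factors of [p] one at a time, the first factor that kills the
    current vector exhibits an eigenvector. *)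
Lemma exists_eigenvector (K : closedFieldType) (W : lmodType K) (T : W -> W)
    (U : set W) (w : W) : linear T -> subspace U -> (forall y, U y -> U (T y)) ->
  finite_dimensional U -> U w -> w <> 0 ->
  exists h v, [/\ U v, v <> 0 & T v = h *: v].
Proof.
move=> Tl sU UT [n [e eU]] Uw w0.
have Uit i : U (iter i T w) by elim: i => [//|i Ui]; apply: UT.
have [a [i0 ai0] Ea] : exists2 a : 'I_n.+1 -> K, exists i, a i != 0 &
    \sum_i a i *: iter i T w = 0.
  by apply: (dependent_vectors (t := e)) => // i; apply: eU.
pose ev (p : {poly K}) (v : W) := \sum_(i < size p) p`_i *: iter i T v.
have evE (p : {poly K}) v m : (size p <= m)%N -> ev p v = \sum_(i < m) p`_i *: iter i T v.
  move=> pm; rewrite /ev (big_ord_widen _ (fun i => p`_i *: iter i T v) pm).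
  rewrite big_mkcond; apply: eq_bigr => i _; case: ltnP => // /(nth_default 0) ->.
  by rewrite scale0r.
have evM c (p : {poly K}) v : ev (('X - c%:P) * p) v = ev p (T v - c *: v).
  have sz : (size (('X - c%:P) * p)%R <= (size p).+1)%N.
    by apply: leq_trans (size_polyMleq _ _) _; rewrite size_XsubC.
  rewrite (evE _ _ _ sz) /ev big_ord_recl.
  have ->: \sum_(i < size p) (('X - c%:P) * p)`_(lift ord0 i) *: iter (lift ord0 i) T v
     = \sum_(i < size p) p`_i *: iter i T (T v) - \sum_(i < size p) (c * p`_i.+1) *: iter i.+1 T v.
    rewrite -sumrB; apply: eq_bigr => i _.
    by rewrite mulrBl coefB coefXM /= coefCM -iterSr iterS scalerBl.
  rewrite mulrBl coefB coefXM eqxx coefCM sub0r.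
  have Tit i : linear (iter i T) by elim: i => [|i IHi] b x y //=; rewrite IHi Tl.
  transitivity (\sum_(i < size p) p`_i *: iter i T (T v) -
     \sum_(i < (size p).+1) (c * p`_i) *: iter i T v).
    rewrite [in RHS]big_ord_recl /=; set S := \sum_(i < size p) (c * p`_i.+1) *: _.
    by lmod_eq K.
  rewrite big_ord_recr /= nth_default // mulr0 scale0r addr0 -sumrB.
  apply: eq_bigr => i _; rewrite (lin_sub (Tit i)) (lin_scale (Tit i)).
  by lmod_eq K.
pose p := \poly_(i < n.+1) (if insub i is Some j then a j else 0).
have pw : ev p w = 0.
  rewrite (evE _ _ n.+1) ?size_poly // -[RHS]Ea; apply: eq_bigr => i _.
  by rewrite coef_poly ltn_ord valK.
have p0 : p != 0.
  by apply/eqP => /polyP /(_ i0); rewrite coef_poly ltn_ord valK coef0; apply/eqP.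
have [rs Ep] := closed_field_poly_normal p.
move: pw; rewrite Ep.
have evZ c (q : {poly K}) v : ev (c *: q) v = c *: ev q v.
  rewrite (evE _ _ (size q)) ?size_scale_leq // /ev scaler_sumr.
  by apply: eq_bigr => i _; rewrite coefZ scalerA.
rewrite evZ => /eqP; rewrite scaler_eq0 lead_coef_eq0 (negPf p0) /= => /eqP.
elim: rs w Uw w0 {Ep Uit Ea evZ} => [|c rs IH] w Uw w0.
  by rewrite big_nil /ev size_poly1 big_ord1 coef1 scale1r.
rewrite big_cons evM.
have [E _|N0] := pselect (T w - c *: w = 0).
  by exists c, w; split=> //; apply/eqP; rewrite -subr_eq0; apply/eqP.
by apply: IH => //; apply: subB => //; [apply: UT|apply: subZ].
Qed.

(** * Submodules, products and parity shifts of modules *)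

Section Grading.
Context (K : fieldType) (W : lmodType K) (par : bool -> set W) (G : Z2_grading par).

Lemma grading_uniq a b c d : par false a -> par true b -> par false c -> par true d ->
  a + b = c + d -> a = c /\ b = d.
Proof.
move=> pa pb pc pd E.
have Ea : a = c + d - b by rewrite -E addrK.
have Eac : a - c = d - b by rewrite Ea; lmod_eq K.
have Z : a - c = 0.
  apply: (par_direct G); first exact: (subB (par_subspace G _)).
  by rewrite Eac; apply: (subB (par_subspace G _)).
by split; apply/eqP; rewrite -subr_eq0; last rewrite -opprB -Eac oppr_eq0; apply/eqP.
Qed.

Lemma component_exists w : exists x : bool -> W,
  (forall b, par b (x b)) /\ w = x false + x true.
Proof.
have [w0 [w1 [p0 p1 ->]]] := par_span G w.
by exists (fun b => if b then w1 else w0); split=> // -[].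
Qed.

Definition component w : bool -> W := sval (cid (component_exists w)).

Lemma component_par w b : par b (component w b).
Proof. exact: (svalP (cid (component_exists w))).1. Qed.

Lemma componentE w : w = component w false + component w true.
Proof. exact: (svalP (cid (component_exists w))).2. Qed.

Lemma component_eq w (x : bool -> W) : (forall b, par b (x b)) ->
  w = x false + x true -> component w =1 x.
Proof.
move=> px Ew b.
have [E0 E1] := grading_uniq (component_par w false) (component_par w true)
  (px false) (px true) (etrans (esym (componentE w)) Ew).
by case: b.
Qed.

Lemma component_lin b : linear (fun w => component w b).
Proof.
move=> a x y.
rewrite (@component_eq _ (fun b => a *: component x b + component y b)) //.
  by move=> b'; apply: (par_subspace G b').2; apply: component_par.
by rewrite {1}[x]componentE {1}[y]componentE; lmod_eq K.
Qed.

Lemma component_homog p w b : par p w -> component w b = if b == p then w else 0.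
Proof.
move=> pw; rewrite (@component_eq _ (fun b => if b == p then w else 0)) //.
  by move=> b'; case: eqP => [->//|_]; apply: sub0; apply: par_subspace.
by case: (p); rewrite ?add0r ?addr0.
Qed.


End Grading.

Lemma component_map (K : fieldType) (W W' : lmodType K) (par : bool -> set W)
    (par' : bool -> set W') (G : Z2_grading par) (G' : Z2_grading par') (f : W -> W') q :
  linear f -> (forall p w, par p w -> par' (q (+) p) (f w)) ->
  forall w b, component G' (f w) b = f (component G w (q (+) b)).
Proof.
move=> fl fp w b.
rewrite (@component_eq _ _ _ _ _ (fun b => f (component G w (q (+) b)))) //.
  by move=> b'; have := fp _ _ (component_par G w (q (+) b')); rewrite addKb.
rewrite {1}(componentE G w) (lin_add fl) addbF addbT.
by case: (q); rewrite //= addrC.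
Qed.

Lemma homog_ind (K : fieldType) (W : lmodType K) (par : bool -> set W)
    (P : W -> Prop) : Z2_grading par -> (forall x y, P x -> P y -> P (x + y)) ->
  (forall p w, par p w -> P w) -> forall w, P w.
Proof.
by move=> G PD Ph w; rewrite (componentE G w); apply: PD; apply: Ph; apply: component_par.
Qed.

Section JointEmbedding.
Context (K : fieldType) (V : lmodType K) (parV : bool -> set V) (Y : V -> int -> V -> V)
  (vac omega : V) (c : K).
Context (W1 : lmodType K) (par1 : bool -> set W1) (Y1 : V -> int -> W1 -> W1).
Context (W2 : lmodType K) (par2 : bool -> set W2) (Y2 : V -> int -> W2 -> W2).
Context (ax1 : module_axioms parV Y vac omega c par1 Y1).
Context (ax2 : module_axioms parV Y vac omega c par2 Y2).
Context (X : lmodType K) (f1 : X -> W1) (f2 : X -> W2) (YX : V -> int -> X -> X).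
Context (f1_lin : linear f1).
Context (f2_lin : linear f2).
Context (f_inj : forall x y, f1 x = f1 y -> f2 x = f2 y -> x = y).
Context (f1Y : forall v n x, f1 (YX v n x) = Y1 v n (f1 x)).
Context (f2Y : forall v n x, f2 (YX v n x) = Y2 v n (f2 x)).

Definition joint_par b : set X := [set x | par1 b (f1 x) /\ par2 b (f2 x)].

Context (parX_span : forall x, exists x0 x1,
  [/\ joint_par false x0, joint_par true x1 & x = x0 + x1]).

(** All axioms but one are equations or parity conditions that a jointly injective pair of
    intertwining maps detects; the exception, existence of homogeneous components, is [parX_span].
    Products use the two projections, submodules use the inclusion twice. *)
Lemma module_axioms_joint : module_axioms parV Y vac omega c joint_par YX.
Proof.
have [g1 ll1 lr1 p1 t1 v1 J1 Vir1 d1] := ax1.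
have [g2 ll2 lr2 p2 t2 v2 J2 Vir2 d2] := ax2.
split.
- split=> // [b|w [w1 w2] [w1' w2']].
    split; first by split; rewrite lin_zero //; apply: sub0; apply: par_subspace.
    move=> a x y [x1 x2] [y1 y2]; split.
      by rewrite f1_lin; apply: (par_subspace g1 b).2.
    by rewrite f2_lin; apply: (par_subspace g2 b).2.
  by apply: f_inj; rewrite lin_zero //; [apply: (par_direct g1)|apply: (par_direct g2)].
- by move=> n w a u v; apply: f_inj; rewrite ?f1_lin ?f2_lin ?f1Y ?f2Y ?ll1 ?ll2.
- by move=> v n a x y; apply: f_inj; rewrite ?f1_lin ?f2_lin ?f1Y ?f2Y ?f1_lin ?f2_lin ?lr1 ?lr2.
- by move=> p q v n w pv [w1 w2]; split; rewrite ?f1Y ?f2Y; [apply: p1|apply: p2].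
- move=> v w; have [N1 H1] := t1 v (f1 w); have [N2 H2] := t2 v (f2 w).
  exists (Num.max N1 N2) => n; rewrite ge_max => /andP[n1 n2].
  by apply: f_inj; rewrite ?f1Y ?f2Y ?H1 ?H2 ?lin_zero.
- by move=> n w; apply: f_inj; rewrite ?f1Y ?f2Y ?v1 ?v2; case: ifP => // _; rewrite lin_zero.
- move=> p q u v w l m n pu pv.
  have [M1 H1] := J1 p q u v (f1 w) l m n pu pv.
  have [M2 H2] := J2 p q u v (f2 w) l m n pu pv.
  exists (maxn M1 M2) => M; rewrite geq_max => /andP[/H1 E1 /H2 E2].
  apply: f_inj; rewrite ?(lin_sum f1_lin) ?(lin_sum f2_lin).
    under eq_bigr do rewrite (lin_scale f1_lin) f1Y.
    by rewrite E1; apply: eq_bigr => i _; rewrite (lin_scale f1_lin) (lin_sub f1_lin) (lin_scale f1_lin) !f1Y.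
  under eq_bigr do rewrite (lin_scale f2_lin) f2Y.
  by rewrite E2; apply: eq_bigr => i _; rewrite (lin_scale f2_lin) (lin_sub f2_lin) (lin_scale f2_lin) !f2Y.
- move=> m n w; apply: f_inj.
    by rewrite (lin_sub f1_lin) (lin_add f1_lin) !(lin_scale f1_lin) /Virasoro !f1Y; apply: Vir1.
  by rewrite (lin_sub f2_lin) (lin_add f2_lin) !(lin_scale f2_lin) /Virasoro !f2Y; apply: Vir2.
- by move=> v n w; apply: f_inj; rewrite ?(lin_opp f1_lin) ?(lin_opp f2_lin) ?(lin_scale f1_lin) ?(lin_scale f2_lin) ?f1Y ?f2Y ?d1 ?d2.
Qed.
End JointEmbedding.

Section ParityShift.
Context (K : fieldType) (V : vosa K) (b : bool).

(** The sign is that of [hom_of_parity], so that the identity map from [W] to its shift is a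
    morphism of parity [b]. *)
Definition parity_twist (v : V) : V :=
  let x := component (ma_grading (v_adjoint V)) v in x false + (-1) ^+ b *: x true.

Lemma parity_twist_lin : linear parity_twist.
Proof. by move=> a x y; rewrite /parity_twist /= !component_lin; lmod_eq K. Qed.

Lemma parity_twist_homog p v : vpar p v -> parity_twist v = sgnp K b p *: v.
Proof.
move=> pv; rewrite /parity_twist /= !(component_homog _ _ pv) /sgnp.
by case: p pv => pv /=; rewrite ?andbT ?andbF ?scaler0 ?addr0 ?add0r ?scale1r.
Qed.

Lemma parity_twist_par p v : vpar p v -> vpar p (parity_twist v).
Proof.
by move=> pv; rewrite (parity_twist_homog pv); apply: subZ => //; apply: par_subspace (ma_grading (v_adjoint V)) _.
Qed.

Context (W : vmodule V).
Definition shift_par q : set W := mpar (b (+) q).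
Definition shift_Y (v : V) n (w : W) : W := mY (parity_twist v) n w.

Lemma shift_axioms :
  module_axioms (@vpar K V) (@vY K V) (vvac V) (vomega V) (vcharge V) shift_par shift_Y.
Proof.
have [g ll lr p t vc J Vir d] := m_axioms W.
have tvac : parity_twist (vvac V) = vvac V.
  by rewrite (parity_twist_homog (v_vac_even V)) /sgnp andbF scale1r.
have tom : parity_twist (vomega V) = vomega V.
  by rewrite (parity_twist_homog (v_omega_even V)) /sgnp andbF scale1r.
split.
- split=> [q|w|w]; rewrite /shift_par.
  + exact: (par_subspace g).
  + exists (component g w b), (component g w (b (+) true)).
    rewrite addbF; split; try exact: component_par.
    by rewrite {1}(componentE g w) addbT; case: (b); rewrite //= addrC.
  + by rewrite addbF addbT; case: (b) => /= *; apply: (par_direct g).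
- by move=> n w a x y; rewrite /shift_Y parity_twist_lin ll.
- by move=> v n a x y; rewrite /shift_Y lr.
- move=> p' q v n w pv qw; rewrite /shift_par /shift_Y addbCA.
  by apply: p => //; apply: parity_twist_par.
- by move=> v w; apply: t.
- by move=> n w; rewrite /shift_Y tvac vc.
- move=> p' q u v w l m n pu pv.
  have [M HM] := J p' q u v w l m n pu pv; exists M => M' /HM E.
  (* Parities add under [vY], so the twist multiplies both sides of the Jacobi identity by the
     product of the signs of [u] and [v]. *)
  rewrite /shift_Y; transitivity ((sgnp K b p' * sgnp K b q) *:
      \sum_(i < M') binz K m i *: mY (vY u (l + i%:Z) v) (m + n - i%:Z) w).
    rewrite scaler_sumr; apply: eq_bigr => i _.
    rewrite (parity_twist_homog (ma_par (v_adjoint V) _ pu pv)) (lin_scale (ll _ _)) !scalerA.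
    congr (_ *: _); rewrite mulrC; congr (_ * _); rewrite /sgnp.
    by case: (b); case: (p'); case: (q); rewrite /= ?expr0 ?expr1; ring.
  rewrite E scaler_sumr; apply: eq_bigr => i _.
  rewrite (parity_twist_homog pu) (parity_twist_homog pv) !(lin_scale (ll _ _)) !(lin_scale (lr _ _)).
  lmod_eq K.
- by move=> m n w; rewrite /Virasoro /shift_Y tom; apply: Vir.
- move=> v n w; rewrite /shift_Y -d; congr (mY _ _ _).
  move: v; apply: (homog_ind (ma_grading (v_adjoint V))) => [x y Ex Ey|q v qv].
    have lY := ma_linr (v_adjoint V) (vomega V) 0.
    by rewrite (lin_add lY) !(lin_add parity_twist_lin) (lin_add lY) Ex Ey.
  rewrite (parity_twist_homog qv) (lin_scale (ma_linr (v_adjoint V) _ _)).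
  by rewrite (@parity_twist_homog q) //; have := ma_par (v_adjoint V) 0 (v_omega_even V) qv.
Qed.

Definition parity_shift : vmodule V := VModule shift_axioms.

End ParityShift.

Section Product.
Context (K : fieldType) (V : vosa K) (A B : vmodule V).

Definition prod_Y (v : V) n (x : A * B) : A * B := (mY v n x.1, mY v n x.2).

Lemma fst_lin : linear (fst : A * B -> A). Proof. by []. Qed.
Lemma snd_lin : linear (snd : A * B -> B). Proof. by []. Qed.

Lemma prod_axioms : module_axioms (@vpar K V) (@vY K V) (vvac V) (vomega V) (vcharge V)
  (joint_par (@mpar K V A) (@mpar K V B) fst snd) prod_Y.
Proof.
apply: (module_axioms_joint (m_axioms A) (m_axioms B) fst_lin snd_lin) => //.
  by move=> [? ?] [? ?] /= -> ->.
move=> [a b]; have [gA gB] := (ma_grading (m_axioms A), ma_grading (m_axioms B)).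
exists (component gA a false, component gB b false), (component gA a true, component gB b true).
split; try by split; apply: component_par.
by rewrite {1}(componentE gA a) {1}(componentE gB b).
Qed.

Definition prod_module : vmodule V := VModule prod_axioms.

End Product.

Section Subspace.
Context (K : fieldType) (W : lmodType K) (U : set W).

(** The proof is an argument so that the closure instance can be inferred from the predicate. *)
Definition subspace_pred (_ : subspace U) : {pred W} := fun x => `[< U x >].

Lemma subspace_pred_closed sU : submod_closed (subspace_pred sU).
Proof.
split; first by apply/asboolP; apply: sub0.
by move=> a x y /asboolP Ux /asboolP Uy; apply/asboolP; apply: sU.2.
Qed.

HB.instance Definition _ sU :=
  GRing.isSubmodClosed.Build K W (subspace_pred sU) (subspace_pred_closed sU).

Record subspace_type (sU : subspace U) := SubspaceType {
  incl : W; incl_in : incl \in subspace_pred sU }.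

HB.instance Definition _ sU := [isSub for @incl sU].
HB.instance Definition _ sU := [Choice of subspace_type sU by <:].
HB.instance Definition _ sU := [SubChoice_isSubLmodule of subspace_type sU by <:].

Lemma incl_lin sU : linear (@incl sU).
Proof. by []. Qed.

Lemma incl_inj sU : injective (@incl sU).
Proof. exact: val_inj. Qed.

Lemma inclP sU (x : subspace_type sU) : U (incl x).
Proof. by apply/asboolP; apply: incl_in. Qed.

Definition restrict sU (x : W) (Ux : U x) : subspace_type sU :=
  SubspaceType (introT (asboolP _) Ux : x \in subspace_pred sU).

End Subspace.

Section Submodules.
Context (K : fieldType) (V : vosa K) (W : vmodule V) (U : set W) (HU : submodule U).

Let sU := sub_space HU.

Definition sub_Y (v : V) n (x : subspace_type sU) : subspace_type sU :=
  restrict sU (sub_stable HU v n (inclP x)).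

Lemma sub_axioms : module_axioms (@vpar K V) (@vY K V) (vvac V) (vomega V) (vcharge V)
  (joint_par (@mpar K V W) (@mpar K V W) (@incl _ _ _ sU) (@incl _ _ _ sU)) sub_Y.
Proof.
apply: (module_axioms_joint (m_axioms W) (m_axioms W) (incl_lin (sU := sU)) (incl_lin (sU := sU))) => //.
  by move=> x y /incl_inj.
move=> x; pose g := ma_grading (m_axioms W).
have [U0 U1] : U (component g (incl x) false) /\ U (component g (incl x) true).
  by apply: (sub_graded HU); try exact: component_par; rewrite -componentE; apply: inclP.
exists (restrict sU U0), (restrict sU U1).
split; try by split; apply: component_par.
by apply: incl_inj; rewrite (lin_add (@incl_lin _ _ _ sU)) /=; apply: componentE.
Qed.

Definition sub_module : vmodule V := VModule sub_axioms.

End Submodules.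

(** * Modes of the generators *)

Section Binomials.
Context (K : numFieldType).

Lemma binz0 (m : int) : binz K m 0 = 1.
Proof. by rewrite /binz big_ord0 divr1. Qed.

Lemma binzS (m : int) i : binz K m i.+1 = binz K m i * (m%:~R - i%:R) / i.+1%:R.
Proof. by rewrite /binz big_ord_recr /= factS natrM invfM; ring. Qed.

Lemma binz1 (m : int) : binz K m 1 = m%:~R.
Proof. by rewrite binzS binz0 divr1 mul1r subr0. Qed.

Lemma binz0S i : binz K 0 i.+1 = 0.
Proof. by elim: i => [|i IH]; rewrite binzS ?IH ?mul0r // subr0 mulr0 mul0r. Qed.

Lemma binzN1 i : binz K (-1) i = (-1) ^+ i.
Proof.
elim: i => [|i IH]; first by rewrite binz0.
rewrite binzS IH exprS -mulrA mulrC; congr (_ * _).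
have -> : (-1)%:~R - i%:R = - i.+1%:R :> K by rewrite -natr1; ring.
by rewrite mulNr divff // pnatr_eq0.
Qed.

End Binomials.

Section Modes.
Context (K : numFieldType) (V : vosa K) (W : vmodule V).

Lemma mY_linl n (w : W) : linear (fun v : V => mY v n w).
Proof. exact: (ma_linl (m_axioms W)). Qed.

Lemma mY_linr (v : V) n : linear (@mY K V W v n).
Proof. exact: (ma_linr (m_axioms W)). Qed.

Lemma mY_par p q (v : V) n (w : W) : vpar p v -> mpar q w -> mpar (p (+) q) (mY v n w).
Proof. exact: (ma_par (m_axioms W)). Qed.

Lemma mpar_grading : Z2_grading (@mpar K V W).
Proof. exact: (ma_grading (m_axioms W)). Qed.

(* The Jacobi identity for l = 0. *)
Lemma commutator_formula p q (u v : V) (w : W) (m n : int) : vpar p u -> vpar q v ->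
  exists M : nat, forall M', (M <= M')%N ->
    mY u m (mY v n w) - sgnp K p q *: mY v n (mY u m w) =
    \sum_(i < M') binz K m i *: mY (vY u i%:Z v) (m + n - i%:Z) w.
Proof.
move=> pu qv; have [M HM] := ma_Jacobi (m_axioms W) w 0 m n pu qv.
(* At least one summand is required: for [l = 0] the right-hand side consists of the term [i = 0]
   alone. *)
exists (maxn M 1) => [[|M']]; rewrite geq_max ?andbF // => /andP[/HM E _].
transitivity (\sum_(i < M'.+1) binz K m i *: mY (vY u (0 + i%:Z) v) (m + n - i%:Z) w); last first.
  by apply: eq_bigr => i _; rewrite add0r.
rewrite E big_ord_recl /= big1 => [|i _]; last by rewrite binz0S mulr0 scale0r.
by rewrite expr0 binz0 mul1r scale1r !add0r !subr0 !addr0 expr0z mulr1.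
Qed.

(* The Jacobi identity for m = 0. *)
Lemma iterate_formula p q (u v : V) (w : W) (l n : int) : vpar p u -> vpar q v ->
  exists M : nat, forall M', (M <= M')%N ->
    mY (vY u l v) n w =
    \sum_(i < M') ((-1) ^+ i * binz K l i) *:
       (mY u (l - i%:Z) (mY v (n + i%:Z) w)
        - (sgnp K p q * (-1) ^ l) *: mY v (l + n - i%:Z) (mY u i%:Z w)).
Proof.
move=> pu qv; have [M HM] := ma_Jacobi (m_axioms W) w l 0 n pu qv.
exists (maxn M 1) => [[|M']]; rewrite geq_max ?andbF // => /andP[/HM E _].
have : mY (vY u l v) n w = \sum_(i < M'.+1) binz K 0 i *: mY (vY u (l + i%:Z) v) (0 + n - i%:Z) w.
  rewrite big_ord_recl /= big1 => [|i _]; last by rewrite binz0S scale0r.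
  by rewrite binz0 scale1r !addr0 ?subr0 add0r.
move=> ->; rewrite E; apply: eq_bigr => i _; rewrite addr0.
by congr (_ *: (_ - _ *: mY v _ (mY u _ w))); rewrite add0r.
Qed.

(** The case [l = -1] of the iterate formula, where the signs of [binz K (-1) i] cancel and the
    normally ordered product remains. *)
Lemma normal_order_formula p q (u v : V) (w : W) (n : int) : vpar p u -> vpar q v ->
  exists M : nat, forall M', (M <= M')%N ->
    mY (vY u (-1) v) n w =
    \sum_(i < M') (mY u (-1 - i%:Z) (mY v (n + i%:Z) w)
        + sgnp K p q *: mY v (n - 1 - i%:Z) (mY u i%:Z w)).
Proof.
move=> pu qv; have [M HM] := iterate_formula w (-1) n pu qv.
exists M => M' /HM ->; apply: eq_bigr => i _.
rewrite binzN1 -expr2 sqrr_sign scale1r [in _ + n]addrC; congr (_ + _).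
by rewrite -scaleNr; congr (_ *: _); rewrite exprN1 invrN1; ring.
Qed.

End Modes.

Section AffineModes.
Context (K : numFieldType) (k : K) (V : Vk_gl11 k).

Definition act (W : vmodule V) (a : gl11) (r : int) : W -> W := mY (Vk_gen V a) r.

Lemma Vk_rep : affine_rep k (@vpar K V) (fun a n => vY (Vk_gen V a) n).
Proof. by case: (Vk_induced V). Qed.

Lemma gen_vac a (r : int) : 0 <= r -> vY (Vk_gen V a) r (vvac V) = 0.
Proof. by case: (Vk_induced V) => _ _ H _; apply: H. Qed.

Lemma gen_state a : vY (Vk_gen V a) (-1) (vvac V) = Vk_gen V a.
Proof. exact: v_state. Qed.

Lemma gen_par a : vpar (gl11_par a) (Vk_gen V a).
Proof.
by rewrite -gen_state -[gl11_par a]addbF; apply: (ar_par Vk_rep); apply: v_vac_even.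
Qed.

(** Since [a_i] kills the vacuum for [i >= 0], only the commutator of [a_i] with [b_(-1)]
    contributes: the bracket for [i = 0], the central term for [i = 1]. *)
Lemma gen_prod a b (i : nat) : vY (Vk_gen V a) i%:Z (Vk_gen V b) =
  match i with
  | 0 => \sum_(c <- [:: gN; gE; gPsip; gPsim]) gl11_bracket K a b c *: Vk_gen V c
  | 1 => (gl11_form K a b * k) *: vvac V
  | _ => 0
  end.
Proof.
have := ar_bracket Vk_rep a b i%:Z (-1) (vvac V).
rewrite /= (gen_vac a (r := i%:Z)) // (lin_zero (ar_linear Vk_rep b (-1))) scaler0 subr0 gen_state => ->.
case: i => [|[|i]].
- rewrite (_ : (0%:Z + -1 == 0) = false) // scale0r addr0.
  by apply: eq_bigr => c _; rewrite gen_state.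
- rewrite (_ : (1%:Z + -1 == 0) = true) // mul1r big1 ?add0r // => c _.
  by rewrite gen_vac ?scaler0.
- rewrite (_ : (i.+2%:Z + -1 == 0) = false) // scale0r addr0 big1 // => c _.
  by rewrite gen_vac ?scaler0.
Qed.

Section Module.
Context (W : vmodule V).

Lemma act_lin a r : linear (@act W a r).
Proof. exact: mY_linr. Qed.

Lemma act_par a r q (w : W) : mpar q w -> mpar (gl11_par a (+) q) (act a r w).
Proof. by apply: mY_par; apply: gen_par. Qed.

(** The affine relations are given on [V] only. The commutator formula expresses commutators on any
    module through the products [gen_prod], and so transports them. *)
Lemma act_bracket a b r s (w : W) :
  act a r (act b s w) - sgnp K (gl11_par a) (gl11_par b) *: act b s (act a r w) =
  \sum_(c <- [:: gN; gE; gPsip; gPsim]) gl11_bracket K a b c *: act c (r + s) w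
  + (if r + s == 0 then r%:~R * gl11_form K a b * k else 0) *: w.
Proof.
rewrite /act; have [M HM] := commutator_formula w r s (gen_par a) (gen_par b).
rewrite (HM (M + 2)%N) ?leq_addr // addn2 !big_ord_recl /= big1 => [|i _]; last first.
  by rewrite (gen_prod a b i.+2) (lin_zero (mY_linl _ _)) scaler0.
rewrite (gen_prod a b 0) (gen_prod a b 1) binz0 binz1 scale1r subr0 addr0.
rewrite (lin_sum (mY_linl _ _)); congr (_ + _).
  by apply: eq_bigr => c _; rewrite (lin_scale (mY_linl _ _)).
rewrite (lin_scale (mY_linl _ _)) (ma_vac (m_axioms W)) -subr_eq0 opprK subrK.
by case: ifP => _; rewrite ?scaler0 ?scale0r // scalerA mulrA.
Qed.

End Module.

(** The parity index is recorded so that the span is graded and can serve as an affine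
    representation in the universal property. *)
Inductive vac_span : bool -> V -> Prop :=
| vac_span_vac : vac_span false (vvac V)
| vac_span_zero b : vac_span b 0
| vac_span_lin b c x y : vac_span b x -> vac_span b y -> vac_span b (c *: x + y)
| vac_span_act b a r x : vac_span b x ->
    vac_span (gl11_par a (+) b) (vY (Vk_gen V a) r x).

Lemma vac_span_par b x : vac_span b x -> vpar b x.
Proof.
have G := ma_grading (v_adjoint V).
elim=> {b x} [|b|b c x y _ px _ py|b a r x _ px]; first exact: v_vac_even.
- by apply: sub0; apply: par_subspace.
- exact: (par_subspace G b).2.
- exact: (ar_par Vk_rep).
Qed.

Let G : set V := [set x | exists x0 x1, [/\ vac_span false x0, vac_span true x1 & x = x0 + x1]].

Let sG : subspace G.
Proof.
split=> [|a _ _ [x0 [x1 [s0 s1 ->]]] [y0 [y1 [t0 t1 ->]]]].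
  by exists 0, 0; split; try exact: vac_span_zero; rewrite addr0.
exists (a *: x0 + y0), (a *: x1 + y1); split; try exact: vac_span_lin.
by lmod_eq K.
Qed.

Let G_act a r x : G x -> G (vY (Vk_gen V a) r x).
Proof.
move=> [x0 [x1 [s0 s1 ->]]]; rewrite (lin_add (ar_linear Vk_rep a r)).
have := vac_span_act a r s0; have := vac_span_act a r s1.
case: (gl11_par a) => /= t1 t0.
  by exists (vY (Vk_gen V a) r x1), (vY (Vk_gen V a) r x0); rewrite addrC.
by exists (vY (Vk_gen V a) r x0), (vY (Vk_gen V a) r x1).
Qed.

(* The universal property, applied to the span G itself, gives f : V -> G, and its
   uniqueness part shows that the composite of f with the inclusion is the identity. *)
Lemma vac_span_all v : G v.
Proof.
have [rep vev vk univ] := Vk_induced V.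
pose M : lmodType K := subspace_type sG.
pose parM b : set M := [set x | vpar b (incl x)].
pose actM a r (x : M) : M := restrict sG (G_act a r (inclP x)).
have Gvac : G (vvac V).
  exists (vvac V), 0; split; [exact: vac_span_vac|exact: vac_span_zero|].
  by rewrite addr0.
have gr := ma_grading (v_adjoint V).
have il : linear (@incl _ _ _ sG) by exact: incl_lin.
have repM : affine_rep k parM actM.
  split.
  - split=> [b|w|w p0 p1].
    + split; first by rewrite /parM /=; apply: sub0; apply: par_subspace.
      by move=> a x y px py; apply: (par_subspace gr b).2.
    + have [x0 [x1 [s0 s1 E]]] := inclP w.
      have G0 : G x0 by exists x0, 0; split=> //; [exact: vac_span_zero|rewrite addr0].
      have G1 : G x1 by exists 0, x1; split=> //; [exact: vac_span_zero|rewrite add0r].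
      exists (restrict sG G0), (restrict sG G1); split.
      * exact: vac_span_par.
      * exact: vac_span_par.
      * by apply: incl_inj; rewrite (lin_add il).
    + by apply: incl_inj; rewrite (lin_zero il); apply: (par_direct gr).
  - by move=> a r c x y; apply: incl_inj; apply: (ar_linear rep).
  - by move=> a r q w pw; apply: (ar_par rep).
  - move=> a b r s w; apply: incl_inj.
    rewrite (lin_sub il) (lin_scale il) (lin_add il) (lin_scale il) (lin_sum il) /=.
    exact: (ar_bracket rep).
have killM a (r : int) : 0 <= r -> actM a r (restrict sG Gvac) = 0.
  by move=> r0; apply: incl_inj; rewrite (lin_zero il) /=; apply: vk.
have [f [[fl fp fa fv] _]] := univ M parM actM (restrict sG Gvac) repM vev killM.
have [g [_ gu]] := univ V _ _ (vvac V) rep vev vk.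
have E1 : g = id by apply: gu.
have E2 : g = (fun v => incl (f v)).
  apply: gu; split=> [a x y|q x px|a r x|]; first by rewrite fl.
  - exact: fp.
  - by rewrite fa.
  - by rewrite fv.
have := inclP (f v); suff -> : incl (f v) = v by [].
by rewrite -[RHS]/(id v) -E1 E2.
Qed.

Lemma Vk_ind (P : set V) : P (vvac V) -> subspace P ->
  (forall p a r v, vpar p v -> P v -> P (vY (Vk_gen V a) r v)) -> forall v, P v.
Proof.
move=> Pv sP Pa v.
have H b x : vac_span b x -> P x.
  elim=> {b x} [|b|b c x y _ px _ py|b a r x sx px] //; first exact: sub0.
    exact: sP.2.
  by apply: Pa px; apply: vac_span_par sx.
by have [x0 [x1 [/H P0 /H P1 ->]]] := vac_span_all v; apply: subD.
Qed.

(** By the iterate formula the modes of [a_r v] are sums of products of modes of [a] and of [v], so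
    stability spreads from the generators to all of [V] along [Vk_ind]. *)
Lemma submodule_of_act (W : vmodule V) (U : set W) : subspace U ->
  (forall w0 w1, mpar false w0 -> mpar true w1 -> U (w0 + w1) -> U w0 /\ U w1) ->
  (forall a r w, U w -> U (act a r w)) -> submodule U.
Proof.
move=> sU gU aU; split=> // v; move: v.
apply: Vk_ind => [n w Uw|| p a r v pv IH n w Uw].
- by rewrite (ma_vac (m_axioms W)); case: ifP => // _; apply: sub0.
- split=> [n w Uw|c x y Px Py n w Uw]; first by rewrite (lin_zero (mY_linl _ _)); apply: sub0.
  by rewrite mY_linl; apply: sU.2; [apply: Px|apply: Py].
- have [M HM] := iterate_formula w r n (gen_par a) pv.
  rewrite (HM M) //; apply: sub_sum => // i _; apply: subZ => //; apply: subB => //.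
    by apply: aU; apply: IH.
  by apply: subZ => //; apply: IH; apply: aU.
Qed.

End AffineModes.

(** * The Sugawara operator *)

Definition charge (K : numFieldType) (a : gl11) : K :=
  match a with gPsip => 1 | gPsim => -1 | _ => 0 end.

Definition psi (s : bool) : gl11 := if s then gPsip else gPsim.

Section Sugawara.
Context (K : numFieldType) (k : K) (k_neq0 : k != 0) (V : Vk_gl11 k).

Local Notation gens := [:: gN; gE; gPsip; gPsim].

Let quad a b c (i : nat) :
  vY (Vk_gen V a) i%:Z (vY (Vk_gen V b) (-1) (Vk_gen V c)) =
  sgnp K (gl11_par a) (gl11_par b) *:
    vY (Vk_gen V b) (-1) (vY (Vk_gen V a) i%:Z (Vk_gen V c))
  + \sum_(d <- gens) gl11_bracket K a b d *: vY (Vk_gen V d) (i%:Z - 1) (Vk_gen V c)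
  + (if i == 1%N then gl11_form K a b * k else 0) *: Vk_gen V c.
Proof.
have := ar_bracket (Vk_rep V) a b i%:Z (-1) (Vk_gen V c).
rewrite (_ : (i%:Z + -1 == 0) = (i == 1%N)); last by case: i => [|[|i]].
rewrite (_ : (if i == 1%N then _ else 0) = if i == 1%N then gl11_form K a b * k else 0).
  by rewrite -addrA => <-; rewrite addrC subrK.
by case: eqP => // ->; rewrite mul1r.
Qed.

Let vlin a n : linear (vY (Vk_gen V a) n).
Proof. exact: (ar_linear (Vk_rep V)). Qed.

Let omegaE : vomega V =
  (2%:R * k)^-1 *: (vY (Vk_gen V gN) (-1) (Vk_gen V gE) + vY (Vk_gen V gE) (-1) (Vk_gen V gN)
     - vY (Vk_gen V gPsip) (-1) (Vk_gen V gPsim) + vY (Vk_gen V gPsim) (-1) (Vk_gen V gPsip))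
  + (2%:R * k ^+ 2)^-1 *: vY (Vk_gen V gE) (-1) (Vk_gen V gE).
Proof. by rewrite (Vk_omega V) /= !gen_state. Qed.

Let quad0 a b c : vY (Vk_gen V a) 0 (vY (Vk_gen V b) (-1) (Vk_gen V c)) =
  sgnp K (gl11_par a) (gl11_par b) *:
    \sum_(d <- gens) gl11_bracket K a c d *: vY (Vk_gen V b) (-1) (Vk_gen V d)
  + \sum_(d <- gens) gl11_bracket K a b d *: vY (Vk_gen V d) (-1) (Vk_gen V c).
Proof.
rewrite (quad a b c 0) scale0r addr0; congr (_ *: _ + _).
rewrite (gen_prod V a c 0) (lin_sum (vlin _ _)).
by apply: eq_bigr => d _; rewrite (lin_scale (vlin _ _)).
Qed.

Let quad1 a b c : vY (Vk_gen V a) 1 (vY (Vk_gen V b) (-1) (Vk_gen V c)) =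
  (sgnp K (gl11_par a) (gl11_par b) * (gl11_form K a c * k)) *: Vk_gen V b
  + \sum_(d <- gens) gl11_bracket K a b d *:
      \sum_(f <- gens) gl11_bracket K d c f *: Vk_gen V f
  + (gl11_form K a b * k) *: Vk_gen V c.
Proof.
rewrite (quad a b c 1) (gen_prod V a c 1) (lin_scale (vlin _ _)) gen_state scalerA.
congr (_ + _ + _); apply: eq_bigr => d _; congr (_ *: _).
exact: (gen_prod V d c 0).
Qed.

Let quadSS a b c i : vY (Vk_gen V a) i.+2%:Z (vY (Vk_gen V b) (-1) (Vk_gen V c)) =
  (if i == 0%N then \sum_(d <- gens) gl11_bracket K a b d * gl11_form K d c * k else 0)
    *: vvac V.
Proof.
rewrite (quad a b c i.+2) (gen_prod V a c i.+2) (lin_zero (vlin _ _)) scaler0 add0r.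
rewrite scale0r addr0.
have E d : vY (Vk_gen V d) (i.+2%:Z - 1) (Vk_gen V c) =
    (if i == 0%N then gl11_form K d c * k else 0) *: vvac V.
  rewrite (_ : i.+2%:Z - 1 = i.+1%:Z) // gen_prod.
  by case: (i) => [//|j]; rewrite scale0r.
under eq_bigr do rewrite E.
case: (i) => [|j] /=; last by rewrite scale0r big1 // => d _; rewrite scaler0.
by rewrite scaler_suml; apply: eq_bigr => d _; rewrite scalerA mulrA.
Qed.

Let X a b := vY (Vk_gen V a) (-1) (Vk_gen V b).

(** This says that the generators are primary of weight 1. For [a = N] and [i = 1] the fermionic
    part of [omega] leaves [-E/k], which the correction term [E_(-1)^2] cancels. *)
Lemma gen_omega a (i : nat) :
  vY (Vk_gen V a) i%:Z (vomega V) = if i == 1%N then Vk_gen V a else 0.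
Proof.
have two0 : 2%:R != 0 :> K by rewrite pnatr_eq0.
rewrite omegaE (lin_add (vlin _ _)) !(lin_scale (vlin _ _)) !(lin_add (vlin _ _)) (lin_opp (vlin _ _)).
case: i => [|[|i]].
- rewrite !quad0 !big_cons !big_nil -!/(X _ _) /=.
  by case: a => /=; rewrite /sgnp /= ?expr0 ?expr1; lmod_eq K.
- rewrite !quad1 !big_cons !big_nil.
  by case: a => /=; rewrite /sgnp /= ?expr0 ?expr1; lmod_eq K; field; rewrite ?k_neq0 ?two0.
- rewrite !quadSS !big_cons !big_nil.
  by case: a; case: (i) => [|j] /=; lmod_eq K.
Qed.

Section Module.
Context (W : vmodule V).

Lemma act_E (a : gl11) r s (w : W) : act gE r (act a s w) = act a s (act gE r w)
  + (if r + s == 0 then r%:~R * gl11_form K gE a * k else 0) *: w.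
Proof.
have := act_bracket gE a r s w; rewrite /sgnp /= expr0 scale1r.
rewrite big1 ?add0r => [<-|c _]; first by rewrite addrC subrK.
by rewrite scale0r.
Qed.

Lemma act_N (a : gl11) r s (w : W) : act gN r (act a s w) = act a s (act gN r w)
  + charge K a *: act a (r + s) w
  + (if r + s == 0 then r%:~R * gl11_form K gN a * k else 0) *: w.
Proof.
have := act_bracket gN a r s w; rewrite /sgnp /= expr0 scale1r.
rewrite (_ : \sum_(c <- _) _ = charge K a *: act a (r + s) w).
  by move=> H; rewrite -addrA -H addrC subrK.
by rewrite !big_cons big_nil; case: a => /=; lmod_eq K.
Qed.

Lemma psi_same b r s (w : W) :
  act (psi b) r (act (psi b) s w) = - act (psi b) s (act (psi b) r w).
Proof.
have := act_bracket (psi b) (psi b) r s w.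
rewrite !big_cons big_nil /sgnp; case: b => /= H; apply/eqP; rewrite -addr_eq0;
  apply/eqP; move: H; rewrite !scale0r mulr0 mul0r if_same !scale0r !addr0 expr1 scaleN1r opprK //.
Qed.

Lemma psi_opp b r s (w : W) :
  act (psi b) r (act (psi (~~ b)) s w) = - act (psi (~~ b)) s (act (psi b) r w)
  + act gE (r + s) w
  + (if r + s == 0 then charge K (psi b) * r%:~R * k else 0) *: w.
Proof.
have := act_bracket (psi b) (psi (~~ b)) r s w.
rewrite /sgnp.
have -> : gl11_par (psi b) && gl11_par (psi (~~ b)) = true by case: b.
rewrite expr1 scaleN1r opprK => /eqP; rewrite eq_sym -subr_eq eq_sym => /eqP ->.
by rewrite !big_cons big_nil; case: b => /=; case: ifP => _; lmod_eq K.
Qed.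

Lemma Lzero_lin : linear (@Lzero K V W).
Proof. exact: mY_linr. Qed.

(** The commutator is taken with [a_r] on the left of [omega_1], so that only the products computed
    in [gen_omega] enter. *)
Lemma Lzero_act a r (w : W) : Lzero (act a r w) = act a r (Lzero w) - r%:~R *: act a r w.
Proof.
rewrite /Lzero /Virasoro add0r.
have [M HM] := commutator_formula w r 1 (gen_par V a) (v_omega_even V).
have := HM (M + 2)%N (leq_addr _ _).
rewrite addn2 !big_ord_recl /= big1 => [|i _]; last first.
  by rewrite (gen_omega a i.+2) (lin_zero (mY_linl _ _)) scaler0.
rewrite (gen_omega a 0) (gen_omega a 1) /= (lin_zero (mY_linl _ _)) scaler0 binz1 addr0 add0r.
rewrite /sgnp andbF expr0 scale1r (_ : r + 1 - _ = r); last by rewrite addrK.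
by move=> E; rewrite -[X in _ - X]E opprB addrC subrK.
Qed.

(** Summand [i] in the normally ordered expansion of the four mixed terms of [omega] at [L_0];
    exchanging two odd modes costs the inner minus signs. *)
Definition normal_cross (w : W) (i : int) : W :=
  (act gN (-1 - i) (act gE (1 + i) w) + act gE (- i) (act gN i w))
  + (act gE (-1 - i) (act gN (1 + i) w) + act gN (- i) (act gE i w))
  - (act gPsip (-1 - i) (act gPsim (1 + i) w) - act gPsim (- i) (act gPsip i w))
  + (act gPsim (-1 - i) (act gPsip (1 + i) w) - act gPsip (- i) (act gPsim i w)).

Definition normal_square (w : W) (i : int) : W :=
  act gE (-1 - i) (act gE (1 + i) w) + act gE (- i) (act gE i w).

Lemma Lzero_normal (w : W) : exists M : nat, forall M', (M <= M')%N ->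
  Lzero w = (2%:R * k)^-1 *: \sum_(i < M') normal_cross w i%:Z
  + (2%:R * k ^+ 2)^-1 *: \sum_(i < M') normal_square w i%:Z.
Proof.
have H a b : exists M : nat, forall M', (M <= M')%N ->
    mY (vY (Vk_gen V a) (-1) (Vk_gen V b)) 1 w = \sum_(i < M')
     (act a (-1 - i%:Z) (act b (1 + i%:Z) w)
      + sgnp K (gl11_par a) (gl11_par b) *: act b (- i%:Z) (act a i%:Z w)).
  have [M HM] := normal_order_formula w 1 (gen_par V a) (gen_par V b).
  by exists M => M' /HM ->; apply: eq_bigr => i _; rewrite subrr sub0r.
have [M1 H1] := H gN gE; have [M2 H2] := H gE gN; have [M3 H3] := H gPsip gPsim.
have [M4 H4] := H gPsim gPsip; have [M5 H5] := H gE gE.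
exists (maxn (maxn (maxn M1 M2) (maxn M3 M4)) M5) => M'.
rewrite !geq_max => /andP[/andP[/andP[/H1 E1 /H2 E2] /andP[/H3 E3 /H4 E4]] /H5 E5].
rewrite /Lzero /Virasoro add0r omegaE.
rewrite (lin_add (mY_linl _ _)) !(lin_scale (mY_linl _ _)) !(lin_add (mY_linl _ _)) (lin_opp (mY_linl _ _)).
rewrite E1 E2 E3 E4 E5 -sumrN -!big_split /=; congr (_ *: _ + _ *: _); apply: eq_bigr => i _.
  by rewrite /normal_cross /sgnp /= ?expr0 ?expr1; lmod_eq K.
by rewrite /sgnp /= expr0 scale1r.
Qed.

End Module.
End Sugawara.

(** * Vectors annihilated by the spectrally flowed positive modes *)

(* The positive modes, after spectral flow by l units. *)
Definition annihilator (l : int) (a : gl11) (r : int) : bool :=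
  match a with
  | gPsip => - l <= r
  | gPsim => l < r
  | _ => 0 < r
  end.

Section Annihilators.
Context (K : numFieldType) (k : K) (k_neq0 : k != 0) (V : Vk_gl11 k) (W : vmodule V).
Context (l : int).

(** Keeping track of the path shows that the endpoint stays in every submodule containing [v] and
    that its [Re D]-degree has not risen. *)
Inductive ann_path (v : W) : W -> Prop :=
| ann_path_refl : ann_path v v
| ann_path_step a r w : annihilator l a r -> ann_path v w -> ann_path v (act a r w).

Lemma ann_path_trans u v w : ann_path u v -> ann_path v w -> ann_path u w.
Proof. by move=> uv; elim=> {w} [//|a r w ar _]; apply: ann_path_step. Qed.

Lemma ann_path_submodule (U : set W) v w : submodule U -> ann_path v w -> U v -> U w.
Proof. by move=> sU; elim=> {w} [//|a r w _ _ IH /IH Uw]; apply: (sub_stable sU). Qed.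

Section Submodule.
Context (U : set W) (sU : submodule U).

Let Usub := sub_space sU.
Let Uact a r w : U w -> U (act a r w). Proof. exact: (sub_stable sU). Qed.

(** A mode of index [r > 0] lowers [L_0] by [r], and weights in one coset are bounded below, so the
    search for a vector killed modulo [U] ends. In the induction, [d] bounds the room left above
    that limit. *)
Lemma lower_bounded_path h v : grading_restricted W -> ~ U v ->
  gen_eigenspace_of (@Lzero K V W) h v ->
  exists v', [/\ ann_path v v', ~ U v' &
    forall a r, 0 < r -> annihilator l a r -> U (act a r v')].
Proof.
move=> GR; have [N HN] := gr_lower GR h.
suff H d : forall n v, (N <= n + d)%N -> ~ U v -> gen_eigenspace_of (@Lzero K V W) (h - n%:R) v ->
    exists v', [/\ ann_path v v', ~ U v' &
      forall a r, 0 < r -> annihilator l a r -> U (act a r v')].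
  by move=> nU gv; apply: (H N 0%N v) => //; rewrite subr0.
elim: d => [|d IH] n {}v Nn nUv gv.
  rewrite addn0 in Nn; by case: nUv; rewrite (HN n Nn v gv); apply: sub0.
have [killed|/existsNP[a /existsNP[r /not_implyP[r0 /not_implyP[ar nUa]]]]] :=
  pselect (forall a r, 0 < r -> annihilator l a r -> U (act a r v)).
  by exists v; split=> //; apply: ann_path_refl.
case: r r0 ar nUa => // -[//|r] _ ar nUa.
have [|//||v' [p nU' kill]] := IH (n + r.+1)%N (act a r.+1 v).
- by apply: leq_trans Nn _; rewrite -addnA leq_add2l addSn ltnS leq_addl.
- rewrite natrD opprD addrA.
  apply: (gen_eigen_map (f := act a r.+1) (s := - r.+1%:R) _ _ gv); first exact: act_lin.
  by move=> x; rewrite (Lzero_act k_neq0) scaleNr.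
exists v'; split=> //; apply: ann_path_trans p.
by apply: ann_path_step => //; apply: ann_path_refl.
Qed.

Lemma self_neg (w : W) : w = - w -> w = 0.
Proof.
move=> /eqP; rewrite -subr_eq0 opprK -mulr2n -scaler_nat scaler_eq0 pnatr_eq0 /=.
by move/eqP.
Qed.

Lemma gl11_cases b a : [\/ a = gN, a = gE, a = psi b | a = psi (~~ b)].
Proof. by case: a; case: b; [apply: Or41|apply: Or41|apply: Or42|apply: Or42|apply: Or43|apply: Or44|apply: Or44|apply: Or43]. Qed.

(* Applying psi^b_0, psi^b_(-1), ..., psi^b_(-j) in turn, each at most once. *)
Lemma fermionic_path b (j : nat) v : ~ U v ->
  (forall r, annihilator l (psi b) r = (- j%:Z <= r)) ->
  (forall r, annihilator l (psi (~~ b)) r = (j%:Z < r)) ->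
  (forall a r, 0 < r -> annihilator l a r -> U (act a r v)) ->
  exists v', [/\ ann_path v v', ~ U v' &
    forall a r, annihilator l a r -> U (act a r v')].
Proof.
move=> nUv annb annb' kill.
have formNb : gl11_form K gN (psi b) = 0 by case: (b).
have formEb : gl11_form K gE (psi b) = 0 by case: (b).
(* State after [i] decisions: [psi^b_r] is killed modulo [U] for [r > -i]. The value [i = j + 1] is
   needed to include [r = -j]. *)
suff H i : (i <= j.+1)%N -> exists v', [/\ ann_path v v', ~ U v',
    forall r, 0 < r -> U (act gN r v') /\ U (act gE r v'),
    forall r, j%:Z < r -> U (act (psi (~~ b)) r v') &
    forall r, - i%:Z < r -> - j%:Z <= r -> U (act (psi b) r v')].
  have [v' [p nU NE op same]] := H j.+1 (leqnn _).
  exists v'; split=> // a r; case: (gl11_cases b a) => ->.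
  - by move=> /NE[].
  - by move=> /NE[].
  - by rewrite annb => ?; apply: same => //; lia.
  - by rewrite annb'; apply: op.
elim: i => [|i IH] ij.
  exists v; split=> // [|r r0|r jr|r r0 jr]; first exact: ann_path_refl.
  - by split; apply: kill.
  - by apply: kill; rewrite ?annb' //; lia.
  - by apply: kill; rewrite ?annb //; lia.
have [v' [p nU NE op same]] := IH (ltnW ij).
have [Ui|nUi] := pselect (U (act (psi b) (- i%:Z) v')).
  exists v'; split=> // r ir jr.
  have [->//|rni] := eqVneq r (- i%:Z); apply: same => //; lia.
exists (act (psi b) (- i%:Z) v'); split=> //.
- by apply: ann_path_step p; rewrite annb; lia.
(* Moving [N_r] past [psi^b_(-i)] produces [psi^b_(r-i)], of index above [-i] and hence already
   killed. *)
- move=> r r0; have [UN UE] := NE r r0; split.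
    rewrite act_N formNb mulr0 mul0r if_same scale0r addr0.
    apply: subD => //; first exact: Uact.
    by apply: subZ => //; apply: same; lia.
  by rewrite act_E formEb mulr0 mul0r if_same scale0r addr0; apply: Uact.
(* The anticommutator is [E_(r-i)] with [r > j >= i]: a positive mode, and no central term. *)
- move=> r jr; rewrite -{2}[b]negbK psi_opp negbK.
  have -> : (r - i%:Z == 0) = false by apply/eqP; lia.
  rewrite scale0r addr0; apply: subD => //.
    by apply: subN => //; apply: Uact; apply: op.
  by have [|] := NE (r - i%:Z) _; first by lia.
- move=> r ir jr; have [->|rni] := eqVneq r (- i%:Z).
    have := psi_same b (- i%:Z) (- i%:Z) v' => /self_neg ->; exact: sub0.
  rewrite psi_same; apply: subN => //; apply: Uact; apply: same => //; lia.
Qed.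

Lemma annihilated_path h v : grading_restricted W -> ~ U v ->
  gen_eigenspace_of (@Lzero K V W) h v ->
  exists v', [/\ ann_path v v', ~ U v' &
    forall a r, annihilator l a r -> U (act a r v')].
Proof.
move=> GR nU gv; have [v1 [p1 nU1 kill1]] := lower_bounded_path GR nU gv.
have [b [j [Hb Hb']]] : exists b (j : nat),
    (forall r, annihilator l (psi b) r = (- j%:Z <= r)) /\
    (forall r, annihilator l (psi (~~ b)) r = (j%:Z < r)).
  (* For [l >= 0] the extra nonpositive annihilators are [psi^+_0, ..., psi^+_(-l)]. For [l < 0]
     they are modes of [psi^-], and [r > l] means [r >= -(|l| - 1)], whence the predecessor. *)
  case: (lerP 0 l) => l0.
    exists true, `|l|%N; split=> r /=; lia.
  exists false, (`|l|%N.-1)%N; split=> r /=; lia.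
have [v' [p2 nU2 kill2]] := fermionic_path nU1 Hb Hb' kill1.
by exists v'; split=> //; apply: ann_path_trans p2.
Qed.

(* psi^-_(-i) psi^+_i - psi^+_(-i) psi^-_i acts by this scalar on a vector killed
   by the annihilators on which E_0 = e: one of the two factors kills the vector
   after the anticommutator has been split off. *)
Definition fermion_term (e : K) (i : int) : K :=
  (if i < - l then e + i%:~R * k else 0) - (if i <= l then e - i%:~R * k else 0).

(* The eigenvalue of L_0 - (e/k) N_0 on such vectors. *)
Definition sugawara_shift (e : K) : K :=
  (2%:R * k)^-1 * \sum_(i < `|l|%N.+1) (fermion_term e (1 + i%:Z) + fermion_term e i%:Z)
  + (2%:R * k ^+ 2)^-1 * e ^+ 2.

(** Each normally ordered summand ends in an annihilator, or is a zero-mode product, or becomes a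
    scalar plus a word ending in an annihilator once the two fermions are exchanged. The zero modes
    give [2 e n / (2 k)] and [e^2 / (2 k^2)]. Working modulo [U] covers all subquotients at once. *)
Lemma sugawara_annihilated (e n : K) v : act gE 0 v = e *: v -> act gN 0 v = n *: v ->
  (forall a r, annihilator l a r -> U (act a r v)) ->
  U (Lzero v - (e / k * n + sugawara_shift e) *: v).
Proof.
move=> Ev Nv kill.
have two0 : 2%:R != 0 :> K by rewrite pnatr_eq0.
(* [cp i] and [cm i] are the scalars by which [psi^+_(-i) psi^-_i] and [psi^-_(-i) psi^+_i] act on
   [v] modulo [U]. *)
pose cp (i : int) := if i <= l then e - i%:~R * k else 0.
pose cm (i : int) := if i < - l then e + i%:~R * k else 0.
have Ucp (i j : int) : j = - i -> U (act gPsip j (act gPsim i v) - cp i *: v).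
  move=> ->; rewrite /cp; case: (lerP i l) => il; last first.
    by rewrite scale0r subr0; apply: Uact; apply: kill.
  rewrite (psi_opp true) /= addNr eqxx Ev.
  set x := act gPsim _ _.
  rewrite (_ : _ - _ = - x).
    by apply: subN => //; apply: Uact; apply: kill => /=; rewrite lerN2.
  by rewrite mulrNz; lmod_eq K.
have Ucm (i j : int) : j = - i -> U (act gPsim j (act gPsip i v) - cm i *: v).
  move=> ->; rewrite /cm; case: (ltrP i (- l)) => il; last first.
    by rewrite scale0r subr0; apply: Uact; apply: kill.
  rewrite (psi_opp false) /= addNr eqxx Ev.
  set x := act gPsip _ _.
  rewrite (_ : _ - _ = - x).
    by apply: subN => //; apply: Uact; apply: kill => /=; lia.
  by rewrite mulrNz; lmod_eq K.
have Ubos a b ca cb (i : nat) : (a = gN \/ a = gE) -> (b = gN \/ b = gE) ->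
    act a 0 v = ca *: v -> act b 0 v = cb *: v ->
    U (act a (-1 - i%:Z) (act b (1 + i%:Z) v) + act b (- i%:Z) (act a i%:Z v)
       - (if i == 0%N then ca * cb else 0) *: v).
  move=> aNE bNE Ea Eb; rewrite -addrA; apply: subD => //.
    by apply: Uact; apply: kill; case: bNE => -> /=; lia.
  case: i => [|i] /=.
    rewrite (_ : act a 0%Z v = ca *: v) // (lin_scale (act_lin _ _)).
    rewrite (_ : act b (- 0%Z) v = cb *: v) // scalerA subrr; exact: sub0.
  rewrite scale0r subr0; apply: Uact; apply: kill; case: aNE => -> /=; lia.
have [M HM] := Lzero_normal v.
(* [fermion_term] vanishes at all indices from [L] on, so the scalar does not depend on the
   truncation [M], which varies with [v]. *)
pose L := `|l|%N.+1; pose M' := maxn M L.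
have sumL (F : nat -> K) : (forall i, (L <= i)%N -> F i = 0) ->
    \sum_(i < M') F i = \sum_(i < L) F i.
  move=> F0; rewrite (big_ord_widen _ F (leq_maxr M L)) [RHS]big_mkcond /=.
  by apply: eq_bigr => i _; case: ltnP => // /F0.
pose t (i : nat) := (if i == 0%N then e * n + n * e else 0)
  + (fermion_term e (1 + i%:Z) + fermion_term e i%:Z).
pose s (i : nat) := if i == 0%N then e * e else 0.
have -> : (e / k * n + sugawara_shift e) =
    (2%:R * k)^-1 * (\sum_(i < M') t i) + (2%:R * k ^+ 2)^-1 * \sum_(i < M') s i.
  rewrite !sumL /t /s /sugawara_shift.
  - have sum0 (c : K) : \sum_(i < L) (if i == 0%N :> nat then c else 0) = c.
      by rewrite /L big_ord_recl big1 ?addr0.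
    rewrite big_split /= -/L [in RHS]big_split [in RHS]big_split /= !sum0.
    by field; rewrite ?two0 k_neq0.
  - by case.
  - case=> // i iL; rewrite add0r /fermion_term.
    do 4 (case: ifP => [|_]; first by rewrite /L in iL; lia).
    by rewrite !subr0 addr0.
rewrite (HM M') ?leq_maxl //.
set A := \sum_(i < M') normal_cross _ _; set B := \sum_(i < M') normal_square _ _.
rewrite (_ : _ - _ = (2%:R * k)^-1 *: (A - \sum_(i < M') t i *: v)
  + (2%:R * k ^+ 2)^-1 *: (B - \sum_(i < M') s i *: v)); last first.
  by rewrite -!scaler_suml; lmod_eq K.
rewrite -!sumrB; apply: subD => //; apply: subZ => //; apply: sub_sum => // i _.
  have H1 := Ubos gN gE n e i (or_introl erefl) (or_intror erefl) Nv Ev.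
  have H2 := Ubos gE gN e n i (or_intror erefl) (or_introl erefl) Ev Nv.
  have H3 := Ucp (1 + i%:Z) (-1 - i%:Z) (ltac:(lia)).
  have H4 := Ucm i%:Z (- i%:Z) erefl.
  have H5 := Ucm (1 + i%:Z) (-1 - i%:Z) (ltac:(lia)).
  have H6 := Ucp i%:Z (- i%:Z) erefl.
  have := subD Usub (subD Usub (subD Usub H1 H2) (subB Usub H4 H3)) (subB Usub H5 H6).
  congr (U _); rewrite /t /normal_cross /fermion_term -/(cm _) -/(cp _) -/(cm _) -/(cp _).
  by case: eqP => _; lmod_eq K.
exact: (Ubos gE gE e e i (or_intror erefl) (or_intror erefl) Ev Ev).
Qed.

End Submodule.
End Annihilators.

(** * Weights *)

Section Weights.
Context (K : numFieldType) (k : K) (k_neq0 : k != 0) (V : Vk_gl11 k) (W : vmodule V).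

Definition weight_vector (e h n : K) (w : W) : Prop :=
  [/\ act gE 0 w = e *: w, gen_eigenspace_of (@Lzero K V W) h w & act gN 0 w = n *: w].

Lemma act_N0 a r (w : W) : act gN 0 (act a r w) = act a r (act gN 0 w) + charge K a *: act a r w.
Proof. by rewrite act_N mul0r mul0r if_same scale0r addr0 add0r. Qed.

Lemma act_E0 a r (w : W) : act gE 0 (act a r w) = act a r (act gE 0 w).
Proof. by rewrite act_E mul0r mul0r if_same scale0r addr0. Qed.

Lemma weight_act e h n a r w : weight_vector e h n w ->
  weight_vector e (h - r%:~R) (n + charge K a) (act a r w).
Proof.
move=> [Ew gw Nw]; split.
- by rewrite act_E0 Ew (lin_scale (act_lin _ _)).
- apply: (gen_eigen_map (act_lin a r) _ gw) => x.
  by rewrite (Lzero_act k_neq0) scaleNr.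
- by rewrite act_N0 Nw (lin_scale (act_lin _ _)) scalerDl.
Qed.

(** [L_0], [N_0] and [E_0] are even and commute with the parity projections. This makes it possible
    to choose a homogeneous generator of a cyclic submodule. *)
Lemma weight_component e h n w b : weight_vector e h n w ->
  weight_vector e h n (component (mpar_grading W) w b).
Proof.
set G := mpar_grading W; move=> [Ew [m mw] Nw].
have even_act a r : gl11_par a = false -> forall w, component G (act a r w) b = act a r (component G w b).
  move=> pa u; apply: (component_map _ _ (q := false)); first exact: act_lin.
  by move=> p v pv; have := act_par a r pv; rewrite pa.
have even_L u : component G (Lzero u) b = Lzero (component G u b).
  apply: (component_map _ _ (q := false)); first exact: Lzero_lin.
  by move=> p v pv; apply: (mY_par _ (v_omega_even V) pv).
split.
- by rewrite -even_act // Ew (lin_scale (component_lin G b)).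
- exists m; suff <- : component G (iter m (fun u => Lzero u - h *: u) w) b =
     iter m (fun u => Lzero u - h *: u) (component G w b).
    by rewrite mw (lin_zero (component_lin G b)).
  elim: (m) => [//|m' IH] /=; rewrite -IH (lin_sub (component_lin G b)).
  by rewrite (lin_scale (component_lin G b)) even_L.
- by rewrite -even_act // Nw (lin_scale (component_lin G b)).
Qed.

(** Decompose under [L_0] first, then each piece under [N_0], which commutes with [L_0]. The
    components stay in [U] because [U] is stable under both. *)
Lemma weight_decomposition (U : set W) e w : grading_restricted W ->
  semisimple_operator (mY (v := W) (Vk_gen V gN) 0) -> submodule U ->
  (forall u, U u -> act gE 0 u = e *: u) -> U w ->
  sum_of [set x | U x /\ exists h n, weight_vector e h n x] w.
Proof.
move=> GR ssN sU UE Uw; have Usub := sub_space sU.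
have UL u : U u -> U (Lzero u) by apply: (sub_stable sU).
have UN u : U u -> U (act gN 0 u) by apply: (sub_stable sU).
have NL u : act gN 0 (Lzero u) = Lzero (act gN 0 u) :> W.
  by rewrite (Lzero_act k_neq0) scale0r subr0.
have spaceT : subspace (sum_of [set x | U x /\ exists h n, weight_vector e h n x]).
  apply: sum_of_subspace => a u [Uu [h [n [Eu gu Nu]]]]; split; first exact: subZ.
  exists h, n; split; last by rewrite (lin_scale (act_lin _ _)) Nu; lmod_eq K.
    by rewrite (lin_scale (act_lin _ _)) Eu; lmod_eq K.
  by apply: subZ => //; apply: gen_subspace; apply: Lzero_lin.
have := sum_of_eigen_sub (T := @Lzero K V W) (E := gen_eigenspace_of (@Lzero K V W))
  (Lzero_lin (W := W)) (gen_subspace (Lzero_lin (W := W))) (fun h x Hx => Hx) Usub UL Uw (gr_sum GR w).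
apply: sum_of_least => // u [Uu [h gu]].
pose U' := U `&` gen_eigenspace_of (@Lzero K V W) h.
have := sum_of_eigen_sub (T := act gN 0) (U := U') (w := u) (act_lin gN 0)
  (eigen_subspace (act_lin gN 0)) (eigen_gen (T := act gN 0)).
have sU' : subspace U' by apply: subspaceI => //; apply: gen_subspace; apply: Lzero_lin.
have U'N y : U' y -> U' (act gN 0 y).
  move=> [Uy gy]; split; first exact: UN.
  rewrite -[h]addr0; apply: (gen_eigen_map (act_lin gN 0) _ gy) => z.
  by rewrite NL scale0r addr0.
move=> /(_ sU' U'N (conj Uu gu) (ssN u)).
apply: sum_of_mono => y [[Uy gy] [n Ny]]; split=> //; exists h, n; split=> //.
exact: UE.
Qed.

Definition Dop (x : K) (w : W) : W := Lzero w - x *: act gN 0 w.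

Lemma Dop_lin x : linear (Dop x).
Proof. by move=> a u v; rewrite /Dop Lzero_lin (act_lin gN 0); lmod_eq K. Qed.

Lemma weight_Dop x e h n w : weight_vector e h n w -> gen_eigenspace_of (Dop x) (h - x * n) w.
Proof.
move=> [_ gw Nw]; apply: (gen_joint (Lzero_lin (W := W)) (act_lin gN 0)) => // u.
by rewrite (Lzero_act k_neq0) scale0r subr0.
Qed.

Lemma gen_Dop_act x d a r w : gen_eigenspace_of (Dop x) d w ->
  gen_eigenspace_of (Dop x) (d - (r%:~R + x * charge K a)) (act a r w).
Proof.
move=> gw; apply: (gen_eigen_map (act_lin a r) _ gw) => u.
rewrite /Dop (Lzero_act k_neq0) act_N0 (lin_sub (act_lin a r)) (lin_scale (act_lin a r)).
by lmod_eq K.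
Qed.

End Weights.

(** * Real parts and the floor of [Re x] *)

Section RealParts.
Context (R : realType).
Local Notation Re := (@complex.Re R).

Lemma ReD (x y : R[i]) : Re (x + y) = Re x + Re y. Proof. by case: x; case: y. Qed.
Lemma ReN (x : R[i]) : Re (- x) = - Re x. Proof. by case: x. Qed.
Lemma ReB (x y : R[i]) : Re (x - y) = Re x - Re y. Proof. by rewrite ReD ReN. Qed.
Lemma Re_int (r : int) : Re r%:~R = r%:~R.
Proof. by rewrite -(rmorph_int (real_complex R)). Qed.

(* Minus the change of Re (L_0 - x N_0) under act a r. *)
Definition lowering (x : R[i]) (a : gl11) (r : int) : R := Re (r%:~R + x * charge R[i] a).

Lemma loweringE x a r : lowering x a r =
  r%:~R + match a with gPsip => Re x | gPsim => - Re x | _ => 0 end.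
Proof.
by rewrite /lowering ReD Re_int; case: a => /=; rewrite ?mulr0 ?mulr1 ?mulrN1 ?ReN.
Qed.

Section Floor.
Context (x : R[i]).
Let l := Num.floor (Re x).

Lemma floor_bounds : l%:~R <= Re x /\ Re x < l%:~R + 1.
Proof. by have := floor_itv (Re x); rewrite intrD /l => /andP[]. Qed.

(** The two fermionic cases use the two halves of [l <= Re x < l + 1]: the extreme modes
    [psi^+_(-l)] and [psi^-_(l+1)] have drops [Re x - l] and [l + 1 - Re x]. *)
Lemma lowering_annihilator a r : annihilator l a r -> 0 <= lowering x a r.
Proof.
have [l1 l2] := floor_bounds; rewrite loweringE; case: a => /= H.
- by rewrite addr0 ler0z ltW.
- by rewrite addr0 ler0z ltW.
- have : (- l)%:~R <= r%:~R :> R by rewrite ler_int.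
  by rewrite mulrNz; lra.
- have : (l + 1)%:~R <= r%:~R :> R by rewrite ler_int lezD1.
  by rewrite intrD; lra.
Qed.

Lemma lowering_strict a r : annihilator l a r -> (a = gPsip /\ r = - l) \/ 0 < lowering x a r.
Proof.
have [l1 l2] := floor_bounds; rewrite loweringE; case: a => /= H.
- by right; rewrite addr0 ltr0z.
- by right; rewrite addr0 ltr0z.
- have [->|rl] := eqVneq r (- l); [by left|right].
  have : (1 - l)%:~R <= r%:~R :> R by rewrite ler_int; lia.
  by rewrite intrD mulrNz; lra.
- right; have : (l + 1)%:~R <= r%:~R :> R by rewrite ler_int lezD1.
  by rewrite intrD; lra.
Qed.

Definition creator (a : gl11) (r : int) : bool :=
  match a with
  | gPsip => r < - l
  | gPsim => r <= l
  | _ => r < 0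
  end.

Lemma creator_cases a r :
  [\/ creator a r, (a = gN \/ a = gE) /\ r = 0 | annihilator l a r].
Proof.
case: a => /=.
- case: (ltrgtP r 0) => H; [by apply: Or31|by apply: Or33|by apply: Or32; split; [left|]].
- case: (ltrgtP r 0) => H; [by apply: Or31|by apply: Or33|by apply: Or32; split; [right|]].
- by case: (ltrP r (- l)) => H; [apply: Or31|apply: Or33].
- by case: (lerP r l) => H; [apply: Or31|apply: Or33].
Qed.

Lemma lowering_creator a r : creator a r ->
  lowering x a r <= 0 /\ ((a = gPsim /\ r = l) \/ lowering x a r < 0).
Proof.
have [l1 l2] := floor_bounds; rewrite loweringE; case: a => /= H.
- have : r%:~R < 0 :> R by rewrite ltrz0.
  by rewrite addr0 => H'; split; [apply: ltW|right].
- have : r%:~R < 0 :> R by rewrite ltrz0.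
  by rewrite addr0 => H'; split; [apply: ltW|right].
- have : (r + 1)%:~R <= (- l)%:~R :> R by rewrite ler_int lezD1.
  by rewrite mulrNz intrD => H'; split; [|right]; lra.
- have : r%:~R <= l%:~R :> R by rewrite ler_int.
  move=> H'; split; first by lra.
  have [->|rl] := eqVneq r l; [by left|right].
  have : (r + 1)%:~R <= l%:~R :> R by rewrite ler_int; lia.
  by rewrite intrD; lra.
Qed.

End Floor.
End RealParts.

(** * Cyclic modules generated in lowest degree *)

(** The endpoints are left free, so that chains can be restricted, pulled back and extended at
    either end. Values of [U] beyond [n] are irrelevant. *)
Definition submodule_chain (K : fieldType) (V : vosa K) (W : vmodule V)
    (U0 : set W) (n : nat) : Prop :=
  exists U : nat -> set W,
    (forall i, (i <= n)%N -> submodule (U i) /\ U i `<=` U0) /\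
    (forall i, (i < n)%N -> U i `<=` U i.+1 /\ ~ U i.+1 `<=` U i).

Lemma submodule_zero (K : fieldType) (V : vosa K) (W : vmodule V) : submodule [set (0 : W)].
Proof.
split; first exact: subspace_zero.
- by move=> v n w /= ->; rewrite (lin_zero (ma_linr (m_axioms W) v n)).
- move=> w0 w1 p0 p1 /= E.
  have G := ma_grading (m_axioms W).
  apply: (grading_uniq G p0 p1); rewrite ?E ?addr0 //; apply: sub0; exact: par_subspace.
Qed.

Section LowestDegree.
Context (R : realType) (k : R[i]) (k_neq0 : k != 0) (V : Vk_gl11 k) (W : vmodule V).
Context (GR : grading_restricted W).
Context (ssN : semisimple_operator (mY (v := W) (Vk_gen V gN) 0)).
Context (e : R[i]).

Local Notation Re := (@complex.Re R).
Let x := e / k.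
Let l := Num.floor (Re x).
Let d0 := sugawara_shift k l e.

Lemma weight_ann_path h n (v v' : W) : ann_path l v v' -> weight_vector e h n v ->
  exists h' n', weight_vector e h' n' v' /\ Re (h' - x * n') <= Re (h - x * n).
Proof.
move=> p wv; elim: p => {v'} [|a r w ar _ [h' [n' [wv' le']]]]; first by exists h, n.
exists (h' - r%:~R), (n' + charge _ a); split; first exact: weight_act.
apply: le_trans le'; have := lowering_annihilator ar; rewrite /lowering.
have -> : h' - r%:~R - x * (n' + charge R[i] a) = h' - x * n' - (r%:~R + x * charge R[i] a) by ring.
by rewrite !ReB !ReD; lra.
Qed.

(** For the endpoint [v'], killed modulo [U] by the annihilators, the Sugawara formula puts
    [L_0 v' - (x n' + d0) v'] in [U]. As [v'] is a generalized [h']-eigenvector outside [U],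
    [gen_shift_inj] forces [h' = x n' + d0]. *)
Lemma lowest_degree_path (U : set W) h n (v : W) : submodule U -> ~ U v -> weight_vector e h n v ->
  exists v' h' n', [/\ ann_path l v v', ~ U v', weight_vector e h' n' v',
    h' - x * n' = d0 & Re d0 <= Re (h - x * n)].
Proof.
move=> sU nU wv; have [_ gv _] := wv.
have [v' [p nU' kill]] := annihilated_path k_neq0 l sU GR nU gv.
have [h' [n' [wv' le']]] := weight_ann_path p wv.
suff E : h' - x * n' = d0 by exists v', h', n'; rewrite -E.
have [Ev' gv' Nv'] := wv'.
have UL u : U u -> U (Lzero u) by apply: (sub_stable sU).
have S := sugawara_annihilated k_neq0 sU Ev' Nv' kill.
have [->|ne] := eqVneq h' (x * n' + d0); first by ring.
case: nU'; apply: (gen_shift_inj (Lzero_lin (W := W)) (sub_space sU) UL gv' _ S).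
exact/eqP.
Qed.

(** The case [U = 0]: a path of annihilators ends in degree [d0] and never raises [Re D]. *)
Lemma degree_lower_bound h n (v : W) : weight_vector e h n v -> v <> 0 -> Re d0 <= Re (h - x * n).
Proof.
move=> wv v0; have [|v' [h' [n' []]]] := lowest_degree_path (submodule_zero W) _ wv => //.
Qed.

(** Weight vectors span [U'], so one of them lies outside [U], and its path of annihilators stays in
    [U']. For consecutive terms of a chain this produces a new vector of degree [d0]. *)
Lemma lowest_degree_vector (U U' : set W) w : submodule U -> submodule U' ->
  (forall u, U' u -> act gE 0 u = e *: u) -> U' w -> ~ U w ->
  exists (v : W) h n, [/\ U' v, ~ U v, weight_vector e h n v & h - x * n = d0].
Proof.
move=> sU sU' U'E U'w nUw.
have [v [U'v nUv [h [n wv]]]] : exists v : W, [/\ U' v, ~ U v & exists h n, weight_vector e h n v].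
  apply: contrapT => H; apply: nUw.
  have := weight_decomposition k_neq0 GR ssN sU' U'E U'w.
  apply: sum_of_least; first exact: (sub_space sU).
  by move=> v [U'v wv]; apply: contrapT => nUv; apply: H; exists v.
have [v' [h' [n' [p nU' wv' E _]]]] := lowest_degree_path sU nUv wv.
by exists v', h', n'; split=> //; apply: (ann_path_submodule sU' p).
Qed.

Section Cyclic.
Context (y : W) (h0 n0 : R[i]) (q : bool).
Context (y_weight : weight_vector e h0 n0 y) (y_degree : h0 - x * n0 = d0) (y_par : mpar q y).

Let y' := act gPsip (- l) y.

(* The submodule generated by y: among the annihilators only psi^+_(-l) need not
   kill y, so after adding y' it is enough to close under creators. *)
Inductive cyclic : W -> Prop :=
| cyclic_zero : cyclic 0
| cyclic_gen : cyclic y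
| cyclic_gen' : cyclic y'
| cyclic_lin c u v : cyclic u -> cyclic v -> cyclic (c *: u + v)
| cyclic_act a r u : creator x a r -> cyclic u -> cyclic (act a r u).

Let cyc_sub : subspace cyclic.
Proof. by split; [exact: cyclic_zero|move=> *; exact: cyclic_lin]. Qed.

Let vanish h n (v : W) : weight_vector e h n v -> Re (h - x * n) < Re d0 -> v = 0.
Proof.
move=> wv lt; apply: contrapT => /(degree_lower_bound wv).
by rewrite leNgt lt.
Qed.

Let degree_act (h n : R[i]) a r : h - r%:~R - x * (n + charge _ a) = h - x * n - (r%:~R + x * charge _ a).
Proof. by ring. Qed.

Let y'_weight : weight_vector e (h0 - (- l)%:~R) (n0 + 1) y'.
Proof. exact: (weight_act k_neq0 gPsip (- l) y_weight). Qed.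

Let zero_modes h n (v : W) a : weight_vector e h n v -> a = gN \/ a = gE -> cyclic v -> cyclic (act a 0 v).
Proof.
by move=> [Ev _ Nv] [] -> cv; rewrite ?Ev ?Nv; apply: (subZ cyc_sub).
Qed.

Let annihilate_gen h n (v : W) a r : weight_vector e h n v -> Re (h - x * n) <= Re d0 ->
  act gPsip (- l) v = 0 \/ cyclic (act gPsip (- l) v) -> annihilator l a r -> cyclic (act a r v).
Proof.
move=> wv le special ar; have [[-> ->]|lt] := lowering_strict ar.
  by case: special => [->|//]; exact: cyclic_zero.
rewrite (vanish (weight_act k_neq0 a r wv)); first exact: cyclic_zero.
rewrite degree_act ReB; apply: lt_le_trans le; rewrite ltrBlDr ltrDl; exact: lt.
Qed.

(** On [y] and [y'] an annihilator of strictly positive drop lands below [Re d0], hence at zero.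
    Longer words reduce to shorter ones. *)
Lemma cyclic_act_all a r u : cyclic u -> cyclic (act a r u).
Proof.
move=> cu; elim: cu a r => {u} [||| c u v _ IHu _ IHv|b s u bs cu IH] a r.
- by rewrite (lin_zero (act_lin _ _)); apply: cyclic_zero.
- case: (creator_cases x a r) => [H|[H ->]|H].
  + by apply: cyclic_act => //; apply: cyclic_gen.
  + by apply: (zero_modes y_weight H); apply: cyclic_gen.
  + apply: (annihilate_gen y_weight _ _ H); first by rewrite y_degree.
    by right; apply: cyclic_gen'.
- case: (creator_cases x a r) => [H|[H ->]|H].
  + by apply: cyclic_act => //; apply: cyclic_gen'.
  + by apply: (zero_modes y'_weight H); apply: cyclic_gen'.
  + apply: (annihilate_gen y'_weight _ _ H).
      rewrite (degree_act h0 n0 gPsip) y_degree ReB.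
      have al : annihilator (Num.floor (Re x)) gPsip (- l) by rewrite /= lexx.
      by have := lowering_annihilator al; rewrite /lowering /= => ?; lra.
    (* [psi^+_(-l)] squares to zero, so the one annihilator whose drop may vanish kills [y']. *)
    by left; apply: (self_neg (K := R[i])); rewrite -(psi_same true).
- by rewrite act_lin; apply: cyclic_lin.
(* After moving [a_r] past the creator [b_s], the swapped and the bracket terms apply modes to the
   shorter word [u], where the induction hypothesis holds for every mode. *)
- have /eqP := act_bracket a b r s u; rewrite subr_eq => /eqP ->.
  apply: (subD cyc_sub); last by apply: (subZ cyc_sub); apply: cyclic_act.
  apply: (subD cyc_sub); last exact: (subZ cyc_sub).
  by apply: (sub_sum cyc_sub) => c _; apply: (subZ cyc_sub).
Qed.

Lemma component_act a r (u : W) b :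
  component (mpar_grading W) (act a r u) b = act a r (component (mpar_grading W) u (gl11_par a (+) b)).
Proof. by apply: component_map; [exact: act_lin|move=> p w; exact: act_par]. Qed.

Lemma cyclic_submodule : submodule cyclic.
Proof.
apply: submodule_of_act => [//|w0 w1 p0 p1 cw|]; last exact: cyclic_act_all.
set G := mpar_grading W.
have cc u : cyclic u -> forall b, cyclic (component G u b).
  elim=> {u} [||| c u v _ IHu _ IHv|a r u ar _ IH] b.
  - by rewrite (lin_zero (component_lin G b)); apply: cyclic_zero.
  - rewrite (component_homog G b y_par); case: eqP => _; [exact: cyclic_gen|exact: cyclic_zero].
  - rewrite (component_homog G b (act_par gPsip (- l) y_par)).
    by case: eqP => _; [exact: cyclic_gen'|exact: cyclic_zero].
  - by rewrite (component_lin G b); apply: cyclic_lin.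
  - by rewrite component_act; apply: cyclic_act.
pose z (b : bool) := if b then w1 else w0.
have Ez := @component_eq _ _ _ G (w0 + w1) z _ erefl.
by split; [rewrite -[w0]/(z false)|rewrite -[w1]/(z true)]; rewrite -Ez; try exact: cc; case.
Qed.

Lemma cyclic_least (U : set W) : submodule U -> U y -> cyclic `<=` U.
Proof.
move=> sU Uy u; elim=> {u} [||| c u v _ IHu _ IHv|a r u _ _ IH] //.
- exact: (sub0 (sub_space sU)).
- exact: (sub_stable sU).
- exact: (sub_space sU).2.
- exact: (sub_stable sU).
Qed.

(* Every other word in the creators strictly raises the real part of L_0 - x N_0. *)
Let t (i : 'I_4) : W :=
  match val i with
  | 0 => y
  | 1 => y'
  | 2 => act gPsim l y
  | _ => act gPsim l y'
  end.

Let t_weight i : exists h n, weight_vector e h n (t i).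
Proof.
case: i => [[|[|[|j]]] ij]; rewrite /t /=.
- by exists h0, n0.
- by exists (h0 - (- l)%:~R), (n0 + 1).
- by exists (h0 - l%:~R), (n0 + charge _ gPsim); apply: weight_act.
- by exists (h0 - (- l)%:~R - l%:~R), (n0 + 1 + charge _ gPsim); apply: weight_act.
Qed.

Let high : set W := sum_of [set v : W | exists d, gen_eigenspace_of (Dop x) d v /\ Re d0 < Re d].

Let high_sub : subspace high.
Proof.
apply: sum_of_subspace => a u [d [gu lt]]; exists d; split=> //.
by apply: subZ => //; apply: gen_subspace; apply: Dop_lin.
Qed.

Let decomposed : set W :=
  [set u | exists (c : 'I_4 -> R[i]) z, high z /\ u = \sum_i c i *: t i + z].

Let dec_sub : subspace decomposed.
Proof.
split=> [|a _ _ [c [z [hz ->]]] [c' [z' [hz' ->]]]].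
  exists (fun=> 0), 0; split; first exact: sub0.
  by rewrite big1 ?addr0 // => i _; rewrite scale0r.
exists (fun i => a * c i + c' i), (a *: z + z'); split; first exact: high_sub.2.
have -> : \sum_i (a * c i + c' i) *: t i = a *: (\sum_i c i *: t i) + \sum_i c' i *: t i.
  by rewrite scaler_sumr -big_split; apply: eq_bigr => i _ /=; lmod_eq R[i].
by lmod_eq R[i].
Qed.

Let dec_t i : decomposed (t i).
Proof.
exists (fun j => if j == i then 1 else 0), 0; split; first exact: sub0.
rewrite addr0 (bigD1 i) //= eqxx scale1r big1 ?addr0 // => j /negPf ->.
by rewrite scale0r.
Qed.

Let dec_high z : high z -> decomposed z.
Proof.
move=> hz; exists (fun=> 0), z; split=> //.
by rewrite big1 ?add0r // => i _; rewrite scale0r.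
Qed.

Let high_act a r z : creator x a r -> high z -> high (act a r z).
Proof.
move=> ar; have [le0 _] := lowering_creator ar.
apply: (sum_of_least (U := [set z | high (act a r z)])).
  by apply: subspace_preim => //; apply: act_lin.
move=> v [d [gv lt]]; apply: sum_of_incl; exists (d - (r%:~R + x * charge _ a)).
split; first exact: gen_Dop_act.
by move: le0; rewrite /lowering ReB; lra.
Qed.

(** [psi^-_l] sends the first two vectors [t] to the last two and kills those; any other creator
    strictly raises [Re D], which is at least [Re d0] on each nonzero [t i]. *)
Let dec_act_t a r i : creator x a r -> decomposed (act a r (t i)).
Proof.
move=> ar; have [le0 [[-> ->]|lt0]] := lowering_creator ar.
  case: i => [[|[|[|j]]] ij]; rewrite /t /=.
  - exact: (dec_t (@Ordinal 4 2 isT)).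
  - exact: (dec_t (@Ordinal 4 3 isT)).
  - have /(self_neg (K := R[i])) -> := psi_same false l l y; exact: sub0.
  - have /(self_neg (K := R[i])) -> := psi_same false l l y'; exact: sub0.
apply: dec_high; have [h [n wt]] := t_weight i.
have [->|t0] := pselect (t i = 0).
  by rewrite (lin_zero (act_lin _ _)); apply: sub0.
have le := degree_lower_bound wt t0.
apply: sum_of_incl; exists (h - x * n - (r%:~R + x * charge _ a)).
split; first by apply: gen_Dop_act => //; apply: weight_Dop wt.
by move: lt0; rewrite /lowering [Re (_ - (_ + _))]ReB; lra.
Qed.

Let cyclic_decomposed : cyclic `<=` decomposed.
Proof.
move=> u; elim=> {u} [||| c u v _ IHu _ IHv|a r u ar _ [c [z [hz ->]]]].
- exact: sub0.
- exact: (dec_t (@Ordinal 4 0 isT)).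
- exact: (dec_t (@Ordinal 4 1 isT)).
- exact: dec_sub.2.
- rewrite (lin_add (act_lin a r)); apply: (subD dec_sub); last by apply: dec_high; apply: high_act.
  rewrite (lin_sum (act_lin a r)); apply: (sub_sum dec_sub) => i _.
  by rewrite (lin_scale (act_lin a r)); apply: (subZ dec_sub); apply: dec_act_t.
Qed.

(** Projecting the decomposition of [v] to the generalized [d0]-eigenspace removes the part of
    higher real degree. *)
Lemma cyclic_lowest_degree v : cyclic v -> gen_eigenspace_of (Dop x) d0 v ->
  exists c : 'I_4 -> R[i], v = \sum_i c i *: t i.
Proof.
move=> /cyclic_decomposed [c [z [[m [s [/= hs ->]]] Ev]]] gv.
have [d Hd] := fin_all_exists hs.
have gt (i : 'I_4) : exists d, gen_eigenspace_of (Dop x) d (t i).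
  by have [h [n wt]] := t_weight i; exists (h - x * n); apply: weight_Dop wt.
have [dt Hdt] := fin_all_exists gt.
pose w (i : 'I_(4 + m)) := match split i with inl j => c j *: t j | inr j => s j end.
pose ew (i : 'I_(4 + m)) := match split i with inl j => dt j | inr j => d j end.
have gw i : gen_eigenspace_of (Dop x) (ew i) (w i).
  rewrite /ew /w; case: (split i) => j; last by have [] := Hd j.
  by apply: subZ => //; apply: gen_subspace; apply: Dop_lin.
have Ew : v = \sum_i w i.
  rewrite Ev big_split_ord /=; congr (_ + _); apply: eq_bigr => i _; rewrite /w.
    by rewrite (unsplitK (inl i)).
  by rewrite (unsplitK (inr i)).
have := gen_project (Dop_lin (W := W) x) gv gw Ew.
rewrite big_split_ord /= [X in _ + X]big1 ?addr0.
  move=> ->; exists (fun i => if dt i == d0 then c i else 0).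
  rewrite big_mkcond; apply: eq_bigr => i _; rewrite /w /ew (unsplitK (inl i)).
  by case: eqP => //; rewrite scale0r.
move=> i; rewrite /ew (unsplitK (inr i)) => /eqP E.
by have [_] := Hd i; rewrite E ltxx.
Qed.

Lemma cyclic_chain_bound n : (forall u, cyclic u -> act gE 0 u = e *: u) ->
  submodule_chain cyclic n -> (n <= 4)%N.
Proof.
move=> cE [U [sU stU]]; rewrite leqNgt; apply/negP => n4.
have mono i j : (i <= j)%N -> (j <= n)%N -> U i `<=` U j.
  move=> /subnK <-; elim: (j - i)%N => [|d IH] jn; first by rewrite add0n.
  have jn' : (d + i < n)%N := jn.
  by apply: subset_trans (IH (ltnW jn')) _; case: (stU _ jn').
have Hv (i : 'I_n) : exists v, [/\ U i.+1 v, ~ U i v & exists c : 'I_4 -> R[i], v = \sum_j c j *: t j].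
  have [_ /existsNP[w /not_implyP[Uw nUw]]] := stU i (ltn_ord i).
  have [sUi _] := sU i (ltnW (ltn_ord i)); have [sUi' Uc] := sU i.+1 (ltn_ord i).
  have [v [h [m [Uv nUv wv E]]]] :=
    lowest_degree_vector sUi sUi' (fun u Uu => cE u (Uc u Uu)) Uw nUw.
  exists v; split=> //; apply: cyclic_lowest_degree; first exact: Uc.
  by rewrite -E; apply: weight_Dop wv.
have [v Hv'] := fin_all_exists Hv.
have [a [i0 ai0] Ea] : exists2 a : 'I_n -> R[i], exists i, a i != 0 & \sum_i a i *: v i = 0.
  by apply: (dependent_vectors (t := t)) => // i; case: (Hv' i).
(* At the last index [i] with nonzero coefficient, the relation expresses [v i] through earlier
   [v j], all in [U i], against its choice outside [U i]. *)
case: (@arg_maxnP _ i0 (fun i => a i != 0) (fun i => i : nat) ai0) => i ai maxi.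
have [_ nU _] := Hv' i; apply: nU.
have [sUi _] := sU i (ltnW (ltn_ord i)).
have -> : v i = (a i)^-1 *: (a i *: v i) by rewrite scalerA mulVf ?scale1r.
apply: (subZ (sub_space sUi)).
have /eqP : \sum_(j | j != i) a j *: v j + a i *: v i = 0 by rewrite addrC -[RHS]Ea [RHS](bigD1 i).
rewrite addrC addr_eq0 => /eqP ->; apply: (subN (sub_space sUi)).
apply: (sub_sum (sub_space sUi)) => j ji.
have [->|aj] := eqVneq (a j) 0; first by rewrite scale0r; apply: sub0 (sub_space sUi).
apply: (subZ (sub_space sUi)).
have [Uj _ _] := Hv' j.
apply: (mono j.+1 i) => //; last exact: ltnW.
by rewrite ltn_neqAle (maxi j aj : (j <= i)%N) andbT; exact: ji.
Qed.

End Cyclic.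
End LowestDegree.

(** * Morphisms and closure properties of the category *)

Section Homs.
Context (K : numFieldType) (k : K) (V : Vk_gl11 k).

Section OneHom.
Context (A B : vmodule V) (b : bool) (f : A -> B) (f_hom : hom_of_parity b f).

Lemma hom_lin : linear f. Proof. by case: f_hom. Qed.

Lemma hom_par q a : mpar q a -> mpar (b (+) q) (f a).
Proof. by case: f_hom => _ H _; apply: H. Qed.

Lemma hom_act a r w : f (act a r w) = sgnp K b (gl11_par a) *: act a r (f w).
Proof. by case: f_hom => _ _ H; apply: H; apply: gen_par. Qed.

Lemma sgnp_sqr p q : sgnp K p q * sgnp K p q = 1.
Proof. by rewrite /sgnp -expr2 sqrr_sign. Qed.

Lemma act_hom a r w : act a r (f w) = f (sgnp K b (gl11_par a) *: act a r w).
Proof. by rewrite (lin_scale hom_lin) hom_act scalerA sgnp_sqr scale1r. Qed.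

Lemma submodule_preim (U : set B) : submodule U -> submodule [set a | U (f a)].
Proof.
move=> sU; apply: submodule_of_act.
- exact: (subspace_preim hom_lin (sub_space sU)).
- move=> w0 w1 /hom_par p0 /hom_par p1 /=; rewrite (lin_add hom_lin).
  case: (b) p0 p1 => /= p0 p1; last exact: (sub_graded sU).
  by rewrite addrC => /(sub_graded sU) -/(_ p1 p0) [].
- move=> a r w /= Uw; rewrite hom_act; apply: (subZ (sub_space sU)).
  exact: (sub_stable sU).
Qed.

Lemma submodule_image (U : set A) : submodule U -> submodule (f @` U).
Proof.
move=> sU; have Usub := sub_space sU.
have gA := mpar_grading A.
apply: submodule_of_act.
- split; first by exists 0; [exact: sub0|exact: lin_zero hom_lin].
  move=> c _ _ [x Ux <-] [y Uy <-]; exists (c *: x + y); first exact: Usub.2.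
  exact: hom_lin.
- move=> w0 w1 p0 p1 [u Uu Eu].
  have U2 p : U (component gA u p).
    have [] := sub_graded sU (component_par gA u false) (component_par gA u true).
      by rewrite -componentE.
    by case: p.
  have E p : (if b (+) p then w1 else w0) = f (component gA u p).
    pose w (p : bool) := if p then w1 else w0.
    have := @component_eq _ _ _ (mpar_grading B) (f u) w.
    move=> /(_ _ Eu) H; rewrite -[LHS]/(w (b (+) p)) -H; last by case.
    rewrite (component_map gA (mpar_grading B) (q := b)) ?addKb //; first exact: hom_lin.
    exact: hom_par.
  split.
    by exists (component gA u b) => //; rewrite -E addbb.
  by exists (component gA u (~~ b)) => //; rewrite -E; case: (b).
- move=> a r _ [w Uw <-]; rewrite act_hom; eexists; last by [].
  by apply: (subZ Usub); apply: (sub_stable sU).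
Qed.

End OneHom.

Lemma submoduleI (W : vmodule V) (U U' : set W) : submodule U -> submodule U' ->
  submodule (U `&` U').
Proof.
move=> sU sU'; split; first exact: subspaceI (sub_space sU) (sub_space sU').
- by move=> v n w [Uw U'w]; split; [exact: (sub_stable sU)|exact: (sub_stable sU')].
- move=> w0 w1 p0 p1 [Uw U'w].
  have [? ?] := sub_graded sU p0 p1 Uw; have [? ?] := sub_graded sU' p0 p1 U'w.
  by split.
Qed.

Lemma submodule_full (W : vmodule V) : submodule [set: W].
Proof. by split. Qed.

Lemma even_hom_mY (A B : vmodule V) (f : A -> B) : hom_of_parity false f ->
  forall (v : V) n a, f (mY v n a) = mY v n (f a).
Proof.
move=> [fl _ fY] v n a; rewrite (componentE (ma_grading (v_adjoint V)) v).
rewrite !(lin_add (mY_linl n _)) (lin_add fl).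
by rewrite !(fY _ _ _ _ (component_par _ _ _)) /sgnp /= expr0 !scale1r.
Qed.

Lemma comp_even_hom (A B C : vmodule V) (f : A -> B) (g : B -> C) :
  hom_of_parity false f -> hom_of_parity false g -> hom_of_parity false (g \o f).
Proof.
move=> hf hg; split.
- by move=> c x y; rewrite /= (hom_lin hf) (hom_lin hg).
- by move=> q a qa; apply: (hom_par hg); apply: (hom_par hf).
- by move=> p v n a pv; rewrite /= (even_hom_mY hf) (even_hom_mY hg) /sgnp /= expr0 scale1r.
Qed.

Lemma even_homP (A B : vmodule V) (f : A -> B) : linear f ->
  (forall q a, mpar q a -> mpar q (f a)) ->
  (forall (v : V) n a, f (mY v n a) = mY v n (f a)) -> hom_of_parity false f.
Proof. by move=> fl fp fY; split=> // p v n a _; rewrite fY /sgnp /= expr0 scale1r. Qed.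

End Homs.

(** * The class of admissible modules and its closure properties *)

Section Admissible.
Context (K : numFieldType) (k : K) (k_neq0 : k != 0) (V : Vk_gl11 k).

(** The conditions of [Okfin] other than finite length, which is obtained afterwards from the bound
    on chains. *)
Record admissible (W : vmodule V) : Prop := {
  adm_gr : grading_restricted W;
  adm_N : semisimple_operator (act (W := W) gN 0);
  adm_E : semisimple_operator (act (W := W) gE 0) }.

Lemma admissible_shift b (W : vmodule V) : admissible W -> admissible (parity_shift b W).
Proof.
move=> [[gs gf gl] sN sE].
have EL : @Lzero K V (parity_shift b W) = @Lzero K V W.
  apply/funext => w; rewrite /Lzero /Virasoro /= /shift_Y.
  by rewrite (parity_twist_homog b (v_omega_even V)) /sgnp andbF scale1r.
have Eact a : gl11_par a = false -> act (W := parity_shift b W) a 0 = act (W := W) a 0.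
  move=> pa; apply/funext => w; rewrite /act /= /shift_Y.
  by rewrite (parity_twist_homog b (gen_par V a)) /sgnp pa andbF scale1r.
by split; [split; rewrite EL|rewrite Eact|rewrite Eact].
Qed.

Section Product.
Context (A B : vmodule V).

Let gen_pair (T : A -> A) (T' : B -> B) h (x : A * B) : linear T -> linear T' ->
  gen_eigenspace_of (fun x => (T x.1, T' x.2)) h x <->
  gen_eigenspace_of T h x.1 /\ gen_eigenspace_of T' h x.2.
Proof.
move=> Tl T'l.
have it n (y : A * B) : iter n (fun x => (T x.1, T' x.2) - h *: x) y =
    (iter n (fun a => T a - h *: a) y.1, iter n (fun a => T' a - h *: a) y.2).
  by elim: n => [|n IH]; [case: y|rewrite /= IH].
split=> [[n]|[[n nx] [m mx]]].
  by rewrite it => -[E1 E2]; split; exists n.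
exists (maxn n m); rewrite it (gen_iter_le Tl (leq_maxl n m) nx).
by rewrite (gen_iter_le T'l (leq_maxr n m) mx).
Qed.

Let sum_pair (QA : set A) (QB : set B) (Q : set (A * B)) (x : A * B) :
  subspace (sum_of Q) ->
  (forall a, QA a -> Q (a, 0)) -> (forall b, QB b -> Q (0, b)) ->
  sum_of QA x.1 -> sum_of QB x.2 -> sum_of Q x.
Proof.
move=> sQ QAQ QBQ Ax Bx.
have -> : x = (x.1, 0) + (0, x.2) by case: x {Ax Bx} => a b; congr pair; rewrite /= ?addr0 ?add0r.
apply: (subD sQ).
  have sA : subspace [set a | sum_of Q (a, 0)].
    apply: (subspace_preim (f := fun a => (a, 0)) _ sQ) => c y z.
    by congr pair; rewrite /= scaler0 addr0.
  by apply: (sum_of_least sA _ Ax) => a /QAQ Qa; apply: sum_of_incl.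
have sB : subspace [set b | sum_of Q (0, b)].
  apply: (subspace_preim (f := fun b => (0, b)) _ sQ) => c y z.
  by congr pair; rewrite /= scaler0 addr0.
by apply: (sum_of_least sB _ Bx) => a /QBQ Qa; apply: sum_of_incl.
Qed.

Let semisimple_pair a : semisimple_operator (act (W := A) a 0) ->
  semisimple_operator (act (W := B) a 0) ->
  semisimple_operator (act (W := prod_module A B) a 0).
Proof.
move=> sA sB x; apply: (sum_pair _ _ _ (sA x.1) (sB x.2)).
- apply: sum_of_subspace => c y [h Ey]; exists h.
  exact: (subZ (eigen_subspace (act_lin (W := prod_module A B) a 0) h)).
- move=> y [h Ey]; exists h; rewrite /eigenspace_of /= in Ey *.
  by congr pair; rewrite ?scaler0 //=; apply: (lin_zero (act_lin a 0)).
- move=> y [h Ey]; exists h; rewrite /eigenspace_of /= in Ey *.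
  by congr pair; rewrite ?scaler0 //=; apply: (lin_zero (act_lin a 0)).
Qed.

Lemma admissible_prod : admissible A -> admissible B -> admissible (prod_module A B).
Proof.
move=> [[gsA gfA glA] sNA sEA] [[gsB gfB glB] sNB sEB].
have gP h (x : prod_module A B) : gen_eigenspace_of (@Lzero K V (prod_module A B)) h x <->
    gen_eigenspace_of (@Lzero K V A) h x.1 /\ gen_eigenspace_of (@Lzero K V B) h x.2.
  by apply: gen_pair; exact: Lzero_lin.
split; [split|exact: semisimple_pair|exact: semisimple_pair].
- move=> x; apply: (sum_pair _ _ _ (gsA x.1) (gsB x.2)).
  + apply: sum_of_subspace => c y [h Ey]; exists h.
    exact: (subZ (gen_subspace (Lzero_lin (W := prod_module A B)) h)).
  + move=> a [h ga]; exists h; apply/gP; split=> //.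
    exact: (sub0 (gen_subspace (Lzero_lin (W := B)) h)).
  + move=> a [h ga]; exists h; apply/gP; split=> //.
    exact: (sub0 (gen_subspace (Lzero_lin (W := A)) h)).
- move=> h; have [n [e He]] := gfA h; have [m [f Hf]] := gfB h.
  exists (n + m)%N, (fun i => match split i with inl j => (e j, 0) | inr j => (0, f j) end).
  move=> [a b] /gP[/= /He [c Ea] /Hf [d Eb]].
  exists (fun i => match split i with inl j => c j | inr j => d j end).
  rewrite big_split_ord /= Ea Eb.
  under eq_bigr do rewrite (unsplitK (inl _)).
  under [X in _ = _ + X]eq_bigr do rewrite (unsplitK (inr _)).
  have sA (F : 'I_n -> A) : \sum_i (F i, 0 : B) = (\sum_i F i, 0).
    by apply/esym; apply: (lin_sum (f := fun a => (a, 0 : B))) => s y z;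
      congr pair; rewrite /= scaler0 addr0.
  have sB (F : 'I_m -> B) : \sum_i (0 : A, F i) = (0, \sum_i F i).
    by apply/esym; apply: (lin_sum (f := fun a => (0 : A, a))) => s y z;
      congr pair; rewrite /= scaler0 addr0.
  transitivity (\sum_i (c i *: e i, 0 : B) + \sum_i (0 : A, d i *: f i)).
    by rewrite sA sB; congr pair; rewrite /= ?addr0 ?add0r.
  by congr (_ + _); apply: eq_bigr => i _; congr pair; rewrite /= scaler0.
- move=> h; have [n Hn] := glA h; have [m Hm] := glB h.
  exists (maxn n m) => N; rewrite geq_max => /andP[nN mN] [a b] /gP[/= ga gb].
  by congr pair; [apply: (Hn N)|apply: (Hm N)].
Qed.

End Product.

Section Sub.
Context (W : vmodule V) (U : set W) (sU : submodule U).

Let Usub := sub_space sU.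
Let P := sub_module sU.

Lemma incl_hom : hom_of_parity false (@incl _ _ _ Usub : P -> W).
Proof. by apply: even_homP => // q a []. Qed.

Let sum_restrict (E : K -> set W) x : (forall h, subspace (E h)) ->
  sum_of [set y | U y /\ exists h, E h y] (@incl _ _ _ Usub x) ->
  sum_of [set z : P | exists h, E h (incl z)] x.
Proof.
move=> sE [n [y [/= Hy Ex]]].
exists n, (fun i => restrict Usub (Hy i).1); split; first by move=> i; exact: (Hy i).2.
by apply: incl_inj; rewrite Ex (lin_sum (@incl_lin _ _ _ Usub)).
Qed.

Let semisimple_sub a : semisimple_operator (act (W := W) a 0) ->
  semisimple_operator (act (W := P) a 0).
Proof.
move=> sW x.
have aE h z : act (W := P) a 0 z = h *: z <-> act (W := W) a 0 (incl z) = h *: incl z.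
  by split=> [/(congr1 (@incl _ _ _ Usub))|H]; [|apply: incl_inj].
have := sum_of_eigen_sub (act_lin a 0) (eigen_subspace (act_lin a 0))
  (eigen_gen (T := act (W := W) a 0)) Usub (fun w => @sub_stable _ _ _ _ sU _ _ w) (inclP x) (sW (incl x)).
move=> /(sum_restrict (eigen_subspace (act_lin a 0))).
by apply: sum_of_mono => z [h /aE Ez]; exists h.
Qed.

Lemma admissible_sub : admissible W -> admissible P.
Proof.
move=> [[gs gf gl] sN sE].
have gP h (x : P) : gen_eigenspace_of (@Lzero K V P) h x <->
    gen_eigenspace_of (@Lzero K V W) h (incl x).
  have it n : incl (iter n (fun y : P => Lzero y - h *: y) x) =
      iter n (fun y => Lzero y - h *: y) (incl x).
    by elim: n => [//|n IH]; rewrite /= -IH.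
  split=> -[n nx]; exists n; first by rewrite -it nx.
  by apply: incl_inj; rewrite it nx.
split; [split|exact: semisimple_sub|exact: semisimple_sub].
- move=> x.
  have := sum_of_eigen_sub (Lzero_lin (W := W)) (gen_subspace (Lzero_lin (W := W)))
    (fun h y Hy => Hy) Usub (fun w => @sub_stable _ _ _ _ sU _ _ w) (inclP x) (gs (incl x)).
  move=> /(sum_restrict (gen_subspace (Lzero_lin (W := W)))).
  by apply: sum_of_mono => z [h /gP gz]; exists h.
- move=> h; have [n [e [He sp]]] := finite_dimensional_sub (gf h)
    (subspaceI Usub (gen_subspace (Lzero_lin (W := W)) h)) (fun w H => H.2).
  exists n, (fun i => restrict Usub (He i).1) => x /gP gx.
  have [c Ec] := sp _ (conj (inclP x) gx).
  exists c; apply: incl_inj; rewrite Ec (lin_sum (@incl_lin _ _ _ Usub)).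
  by apply: eq_bigr => i _; rewrite (lin_scale (@incl_lin _ _ _ Usub)).
- move=> h; have [N HN] := gl h; exists N => n Nn x /gP gx.
  by apply: incl_inj; rewrite (HN n Nn _ gx).
Qed.

End Sub.
End Admissible.

(** * Schur lemma and local covers *)

Section Chains.
Context (K : fieldType) (V : vosa K) (W : vmodule V).

Lemma chain0 (U0 : set W) : submodule U0 -> submodule_chain U0 0.
Proof.
move=> sU; exists (fun=> U0); split=> // i _; split=> //.
Qed.

(** [X] takes position [i] and the later terms move up by one. For [i = 0] and [i = n + 1] the chain
    is prolonged at an end, where one of the two side conditions is vacuous. *)
Lemma chain_insert (U0 : set W) (U : nat -> set W) n i (X : set W) :
  (forall j, (j <= n)%N -> submodule (U j) /\ U j `<=` U0) ->
  (forall j, (j < n)%N -> U j `<=` U j.+1 /\ ~ U j.+1 `<=` U j) ->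
  submodule X -> X `<=` U0 -> (i <= n.+1)%N ->
  ((0 < i)%N -> U i.-1 `<=` X /\ ~ X `<=` U i.-1) ->
  ((i <= n)%N -> X `<=` U i /\ ~ U i `<=` X) ->
  submodule_chain U0 n.+1.
Proof.
move=> sU stU sX XU iN lo hi.
exists (fun j => if (j < i)%N then U j else if j == i then X else U j.-1); split=> j jn.
  case: ltnP => ji; first by apply: sU; rewrite -ltnS; apply: leq_trans ji iN.
  case: eqP => // ne; apply: sU; lia.
case: ltnP => ji.
  case: ltnP => ji1.
    by apply: stU; lia.
  have Ei : i = j.+1 by lia.
  by rewrite -Ei eqxx; have := lo; rewrite Ei; apply.
case: ltnP => ji1; first by lia.
case: eqP => [Ej|ne].
  by rewrite Ej (_ : (i.+1 == i) = false); [apply: hi; rewrite -Ej|apply/eqP; lia].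
case: eqP => [Ej|ne']; first by lia.
by case: j jn ji ji1 ne ne' => [|j] jn ji ji1 ne ne' /=; [lia|apply: stU].
Qed.

(** A chain of maximal length admits no insertion. At the ends this yields zero and the whole
    module, in between it yields irreducible steps. *)
Lemma finite_length_max n : submodule_chain [set: W] n ->
  (forall m, submodule_chain [set: W] m -> (m <= n)%N) -> finite_length W.
Proof.
move=> [U [sU stU]] maxn.
have no_insert i X : submodule X -> (i <= n.+1)%N ->
    ((0 < i)%N -> U i.-1 `<=` X /\ ~ X `<=` U i.-1) ->
    ((i <= n)%N -> X `<=` U i /\ ~ U i `<=` X) -> False.
  move=> sX iN lo hi.
  by have := maxn _ (chain_insert sU stU sX (fun _ _ => I) iN lo hi); rewrite ltnn.
exists n, U; split.
- apply/seteqP; split=> [x U0x|_ ->]; last by apply: sub0; apply: sub_space (sU _ _).1.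
  apply: contrapT => x0.
  apply: (no_insert 0%N [set 0]) => //; first exact: submodule_zero.
  move=> _; split=> [_ ->|]; last by move=> /(_ _ U0x).
  by apply: sub0; apply: sub_space (sU _ _).1.
- apply: contrapT => nT; apply: (no_insert n.+1 [set: W]) => //; last by rewrite ltnn.
  by move=> _ /=; split=> // TU; apply: nT; apply/seteqP; split.
- by move=> i iN; apply: (sU i iN).1.
- move=> i iN; have [s1 s2] := stU i iN; split=> //.
    by move=> E; apply: s2; rewrite -E.
  move=> X sX UX XU.
  apply: contrapT => /not_orP[n1 n2].
  apply: (no_insert i.+1 X) => //; first exact: ltnW.
  - by move=> _; split=> // H; apply: n1; apply/seteqP.
  - by move=> _; split=> // H; apply: n2; apply/seteqP.
Qed.

Lemma minimal_submodule (C : set W) (Q : set W -> Prop) N : submodule C -> Q C ->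
  (forall n, submodule_chain C n -> (n <= N)%N) ->
  exists Z, [/\ submodule Z, Z `<=` C, Q Z &
    forall Z', submodule Z' -> Z' `<=` Z -> Q Z' -> Z `<=` Z'].
Proof.
move=> sC QC bound.
pose B n : bool := `[< exists Z, [/\ submodule Z, Z `<=` C, Q Z & ~ submodule_chain Z n] >].
(* Choose Z whose chains are shortest: a chain in a smaller Z' could be extended by Z. *)
have exB : exists n, B n.
  by exists N.+1; apply/asboolP; exists C; split=> // /bound; rewrite ltnn.
case: (ex_minnP exB) => -[|m] /asboolP[Z [sZ ZC QZ nZ]] minB.
  by case: nZ; apply: chain0.
exists Z; split=> // Z' sZ' Z'Z QZ'; apply: contrapT => nZZ'.
have [U [sU stU]] : submodule_chain Z' m.
  apply: contrapT => nZ'; suff /minB : B m by rewrite ltnn.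
  by apply/asboolP; exists Z'; split=> //; apply: subset_trans ZC.
apply: nZ; apply: (@chain_insert Z U m m.+1 Z) => //; last by rewrite ltnn.
- by move=> j jm; have [? ?] := sU j jm; split=> //; apply: subset_trans Z'Z.
- move=> _ /=; have [_ UZ'] := sU m (leqnn _); split; first exact: subset_trans UZ' Z'Z.
  by move=> ZU; apply: nZZ'; apply: subset_trans ZU UZ'.
Qed.

End Chains.

Section Schur.
Context (R : realType) (k : R[i]) (k_neq0 : k != 0) (V : Vk_gl11 k) (S : vmodule V).
Context (S_gr : grading_restricted S) (S_irr : irreducible S).

Lemma act_even_component (W : vmodule V) a r (w : W) b : gl11_par a = false ->
  component (mpar_grading W) (act a r w) b = act a r (component (mpar_grading W) w b).
Proof. by move=> pa; rewrite component_act pa. Qed.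

Lemma submodule_eigen (W : vmodule V) (e : R[i]) :
  submodule [set w : W | act gE 0 w = e *: w].
Proof.
apply: submodule_of_act.
- exact: (eigen_subspace (act_lin gE 0) e).
- move=> w0 w1 p0 p1 /=; rewrite (lin_add (act_lin gE 0)) scalerDr.
  apply: (grading_uniq (mpar_grading W)).
  + exact: (act_par gE 0 p0).
  + exact: (act_par gE 0 p1).
  + by apply: subZ => //; apply: par_subspace (mpar_grading W) _.
  + by apply: subZ => //; apply: par_subspace (mpar_grading W) _.
- by move=> a r w /= E; rewrite act_E0 E (lin_scale (act_lin a r)).
Qed.

Lemma gen_eigenvector_exists : exists h (w : S),
  gen_eigenspace_of (@Lzero _ V S) h w /\ w <> 0.
Proof.
have [[w w0] _] := S_irr; apply: contrapT => H; apply: w0.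
have := gr_sum S_gr w; apply: (sum_of_least (subspace_zero S)) => v [h gv] /=.
by apply: contrapT => v0; apply: H; exists h, v.
Qed.

(** Zero modes commute with [L_0] and so preserve its generalized eigenspaces, which are
    finite-dimensional. *)
Lemma zero_mode_eigenvector a : exists c (w : S), act a 0 w = c *: w /\ w <> 0.
Proof.
have [h [w [gw w0]]] := gen_eigenvector_exists.
have [|c [v [_ v0 Ev]]] := exists_eigenvector (act_lin a 0) (gen_subspace (Lzero_lin (W := S)) h)
  _ (gr_findim S_gr h) gw w0.
  move=> y gy; rewrite -[h]addr0; apply: (gen_eigen_map (act_lin a 0) _ gy) => z.
  by rewrite (Lzero_act k_neq0) !scale0r subr0 addr0.
by exists c, v.
Qed.

Lemma irreducible_full (U : set S) u : submodule U -> U u -> u <> 0 -> U = [set: S].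
Proof. by move=> sU Uu u0; case: (S_irr.2 U sU) => // U0; case: u0; rewrite U0 in Uu. Qed.

Lemma E0_scalar : exists e : R[i], forall w : S, act gE 0 w = e *: w.
Proof.
have [e [w [Ew w0]]] := zero_mode_eigenvector gE.
exists e => u; have := irreducible_full (submodule_eigen S e) Ew w0.
by move=> /seteqP[_]; apply.
Qed.

(** The sum of the [N_0]-eigenspaces is nonzero and is a submodule, because modes shift
    [N_0]-eigenvalues by their charge. For [E_0] the action is scalar. *)
Lemma irreducible_admissible : admissible S.
Proof.
split=> //; last first.
  have [e He] := E0_scalar.
  by move=> w; apply: sum_of_incl; exists e; apply: He.
have [n [w [Nw w0]]] := zero_mode_eigenvector gN.
pose Z : set S := sum_of [set x | exists h, eigenspace_of (act gN 0) h x].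
have Zsub : subspace Z.
  apply: sum_of_subspace => c x [h Ex]; exists h.
  exact: (subZ (eigen_subspace (act_lin gN 0) h)).
have Zcomp u b : Z u -> Z (component (mpar_grading S) u b).
  apply: (sum_of_least (U := [set u | Z (component _ u b)])).
    exact: (subspace_preim (component_lin _ b)).
  move=> x [h Ex]; apply: sum_of_incl; exists h; rewrite /eigenspace_of /= in Ex *.
  by rewrite -act_even_component // Ex (lin_scale (component_lin _ b)).
have sZ : submodule Z.
  apply: submodule_of_act => // [w0' w1 p0 p1 Zw|a r u].
    pose z (b : bool) := if b then w1 else w0'.
    have Ez := @component_eq _ _ _ (mpar_grading S) (w0' + w1) z _ erefl.
    split; [rewrite -[w0']/(z false)|rewrite -[w1]/(z true)];
      by rewrite -Ez; [exact: Zcomp|case].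
  apply: (sum_of_least (U := [set u | Z (act a r u)])).
    exact: (subspace_preim (act_lin a r)).
  move=> x [h Ex]; apply: sum_of_incl; exists (h + charge _ a); rewrite /eigenspace_of /= in Ex *.
  by rewrite act_N0 Ex (lin_scale (act_lin a r)) scalerDl.
have ZT : Z = [set: S].
  by apply: (irreducible_full sZ _ w0); apply: sum_of_incl; exists n.
by move=> u; have : Z u by rewrite ZT.
Qed.

Lemma irreducible_Okfin : Okfin S.
Proof.
have [gr sN sE] := irreducible_admissible; split=> //.
have [[w w0] irr] := S_irr.
exists 1%N, (fun i => if i is 0 then [set 0] else [set: S]); split=> //.
- by case=> [|i] _; [exact: submodule_zero|exact: submodule_full].
- case=> // _; split=> //.
    by move=> E; apply: w0; have : [set: S] w by []; rewrite -E.
  by move=> X sX _ _; apply: irr.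
Qed.

End Schur.

Section LocalCovers.
Context (R : realType) (k : R[i]) (k_neq0 : k != 0) (V : Vk_gl11 k) (S : vmodule V).
Context (S_gr : grading_restricted S) (S_irr : irreducible S).

Definition nonzero_on (W : vmodule V) (rho : W -> S) (U : set W) : Prop :=
  exists2 u, U u & rho u <> 0.

(* U is a local module with head S. Realizing it inside an ambient module W
   avoids carrying a module structure on U. *)
Record local_cover (W : vmodule V) (U : set W) (rho : W -> S) : Prop := {
  lc_adm : admissible W;
  lc_hom : hom_of_parity false rho;
  lc_sub : submodule U;
  lc_nonzero : nonzero_on rho U;
  lc_local : forall Z, submodule Z -> Z `<=` U -> nonzero_on rho Z -> U `<=` Z }.

(** [E_0] is the scalar [e] on S, so the [e]-eigenspace [U1] of [E_0] in [U] already maps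
    nontrivially to S. A vector of degree [d0] in [U1] outside the kernel of [rho] yields the
    generator of [C]. *)
Lemma cyclic_in (W : vmodule V) (U : set W) (rho : W -> S) : admissible W ->
  hom_of_parity false rho -> submodule U -> nonzero_on rho U ->
  exists C, [/\ submodule C, C `<=` U, nonzero_on rho C &
    forall n, submodule_chain C n -> (n <= 4)%N].
Proof.
move=> [gr sN sE] hr sU [u Uu ru].
have [e He] := E0_scalar k_neq0 S_gr S_irr.
have rho_act a r w : rho (act a r w) = act a r (rho w) by exact: (even_hom_mY hr).
have rl := hom_lin hr.
have [u1 [Uu1 Eu1 ru1]] : exists u1, [/\ U u1, act gE 0 u1 = e *: u1 & rho u1 <> 0].
  apply: contrapT => H; apply: ru.
  have := sum_of_eigen_sub (act_lin gE 0) (eigen_subspace (act_lin gE 0))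
    (eigen_gen (T := act (W := W) gE 0)) (sub_space sU) (fun w => sub_stable sU _ _ (w := w)) Uu (sE u).
  apply: (sum_of_least (U := [set w | rho w = 0])).
    exact: (subspace_preim rl (subspace_zero S)).
  move=> v [Uv [c Ev]] /=; apply: contrapT => rv; apply: H; exists v; split=> //.
  have Ec : c *: rho v = e *: rho v by rewrite -He -rho_act Ev (lin_scale rl).
  suff <- : c = e by [].
  have /eqP : (c - e) *: rho v = 0 by rewrite scalerBl Ec subrr.
  by rewrite scaler_eq0 => /orP[|/eqP //]; rewrite subr_eq0 => /eqP.
pose U1 := U `&` [set w | act gE 0 w = e *: w].
have sU1 : submodule U1 by apply: submoduleI => //; apply: submodule_eigen.
pose N1 := U1 `&` [set w | rho w = 0].
have sN1 : submodule N1.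
  by apply: submoduleI => //; apply: (submodule_preim hr (submodule_zero S)).
have [y [h [n [U1y nN1y wy dy]]]] :=
  lowest_degree_vector k_neq0 gr sN sN1 sU1 (fun w => @proj2 _ _) (conj Uu1 Eu1) (fun H => ru1 H.2).
pose G := mpar_grading W.
have Ny b : U1 (component G y b).
  have [|H0 H1] := sub_graded sU1 (component_par G y false) (component_par G y true).
    by rewrite -componentE.
  by case: b.
(* The generator must be homogeneous for [cyclic] to be graded; one of the two components of [y]
   escapes the kernel. *)
have [b ryb] : exists b, rho (component G y b) <> 0.
  apply: contrapT => H; apply: nN1y; split=> //=.
  rewrite (componentE G y) (lin_add rl).
  have Z b : rho (component G y b) = 0 by apply: contrapT => ?; apply: H; exists b.
  by rewrite !Z addr0.
have wyb := weight_component b wy.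
exists (cyclic e (component G y b)); split.
- exact: (cyclic_submodule k_neq0 gr wyb dy (component_par G y b)).
- move=> v /(cyclic_least sU1 (Ny b)) []//.
- by exists (component G y b) => //; apply: cyclic_gen.
- move=> m cm; apply: (cyclic_chain_bound k_neq0 gr sN wyb _ cm) => v.
  by move=> /(cyclic_least sU1 (Ny b)) [].
Qed.

(** Minimality among the submodules of [C] not killed by [rho] is exactly locality; the chain bound
    on [C] makes a minimal one exist. *)
Lemma local_cover_in (W : vmodule V) (U : set W) (rho : W -> S) : admissible W ->
  hom_of_parity false rho -> submodule U -> nonzero_on rho U ->
  exists2 Z, Z `<=` U & local_cover Z rho.
Proof.
move=> aW hr sU nU; have [C [sC CU nC bound]] := cyclic_in aW hr sU nU.
have [Z [sZ ZC nZ min]] := minimal_submodule sC nC bound.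
by exists Z; [exact: subset_trans CU|split].
Qed.

(** The cyclic submodule [C] is not killed by [rho], so by locality it is all of [U] and its bound
    applies. *)
Lemma local_cover_bound (W : vmodule V) (U : set W) (rho : W -> S) n :
  local_cover U rho -> submodule_chain U n -> (n <= 4)%N.
Proof.
move=> [aW hr sU nU loc] [X [sX stX]]; have [C [sC CU nC bound]] := cyclic_in aW hr sU nU.
apply: bound; exists X; split=> // i iN; have [s1 s2] := sX i iN.
by split=> //; apply: subset_trans s2 (loc C sC CU nC).
Qed.

Definition realized_length n : Prop := exists (W : vmodule V) (U : set W) (rho : W -> S),
  local_cover U rho /\ submodule_chain U n.

Lemma maximal_local_cover : exists n, realized_length n /\
  forall m, realized_length m -> (m <= n)%N.
Proof.
pose B n : bool := `[< realized_length n >].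
have exB : exists n, B n.
  (* Some local cover exists: one inside S, for the identity map. *)
  exists 0%N; apply/asboolP.
  have nS : nonzero_on (id : S -> S) [set: S].
    by have [[w w0] _] := S_irr; exists w.
  have idh : hom_of_parity false (id : S -> S) by apply: even_homP.
  have [Z _ lZ] := local_cover_in (irreducible_admissible k_neq0 S_gr S_irr) idh (submodule_full S) nS.
  by exists S, Z, id; split=> //; apply: chain0; apply: lc_sub lZ.
have ubB n : B n -> (n <= 4)%N.
  by move=> /asboolP[W [U [rho [lU cU]]]]; apply: local_cover_bound lU cU.
case: (ex_maxnP exB ubB) => n /asboolP Bn maxn; exists n; split=> // m Bm.
by apply: maxn; apply/asboolP.
Qed.

End LocalCovers.

(** * Projectivity of a maximal local cover *)

Section ProjectiveCover.
Context (R : realType) (k : R[i]) (k_neq0 : k != 0) (V : Vk_gl11 k) (S : vmodule V).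
Context (S_gr : grading_restricted S) (S_irr : irreducible S).

Section Restriction.
Context (W : vmodule V) (U : set W) (sU : submodule U).

Let Usub := sub_space sU.
Let ih := incl_hom sU.

Lemma chain_restrict n : submodule_chain U n -> submodule_chain [set: sub_module sU] n.
Proof.
move=> [X [sX stX]]; exists (fun i => [set w : sub_module sU | X i (incl w)]); split=> i iN.
  by split=> //; have [s _] := sX i iN; apply: (submodule_preim ih s).
have [s1 s2] := stX i iN; have [_ XU] := sX i.+1 iN; split=> [w|H]; first exact: s1.
by apply: s2 => u Xu; have := H (restrict Usub (XU _ Xu)); apply.
Qed.

End Restriction.

Section Maximal.
Context (P : vmodule V) (pi : P -> S) (n : nat).
Context (P_cover : local_cover [set: P] pi).
Context (P_chain : submodule_chain [set: P] n).
Context (n_max : forall m, realized_length S m -> (m <= n)%N).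

Let pi_hom : hom_of_parity false pi := lc_hom P_cover.

Lemma cover_full (Z : set P) : submodule Z -> nonzero_on pi Z -> forall p, Z p.
Proof. by move=> sZ nZ p; apply: (lc_local P_cover). Qed.

Lemma cover_Okfin : Okfin P.
Proof.
have [gr sN sE] := lc_adm P_cover; split=> //.
apply: (finite_length_max P_chain) => m cm; apply: n_max.
by exists P, [set: P], pi.
Qed.

Lemma cover_surjective y : exists x, pi x = y.
Proof.
have sI := submodule_image pi_hom (submodule_full P).
have [u _ nu] := lc_nonzero P_cover.
have [x _ <-] : (pi @` [set: P]) y; last by exists x.
by rewrite (irreducible_full S_irr sI _ nu) //; exists u.
Qed.

Section Lifting.
Context (A B : vmodule V) (b b' : bool) (q : A -> B) (f : P -> B).
Context (A_adm : admissible A).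
Context (q_hom : hom_of_parity b' q).
Context (q_surj : forall y, exists x, q x = y).
Context (f_hom : hom_of_parity b f).

(* The shift makes both maps to B have the same parity. *)
Let A' := parity_shift (b (+) b') A.
Let X := prod_module P A'.
Let rho (z : X) : S := pi z.1.
Let E : set X := [set z | f z.1 = q z.2].

Let fst_hom : hom_of_parity false (fst : X -> P).
Proof. by apply: even_homP => // c x []. Qed.

Let rho_hom : hom_of_parity false rho.
Proof. exact: (comp_even_hom fst_hom pi_hom). Qed.

Let act_shift a r (w : A') : act (W := A') a r w = sgnp _ (b (+) b') (gl11_par a) *: act (W := A) a r w.
Proof.
rewrite /act /= /shift_Y (parity_twist_homog _ (gen_par V a)).
by rewrite (lin_scale (mY_linl _ _)).
Qed.

Let E_submodule : submodule E.
Proof.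
have fl := hom_lin f_hom; have ql := hom_lin q_hom.
apply: submodule_of_act.
- split=> [|c [p a] [p' a']]; rewrite /E /=; first by rewrite (lin_zero fl) (lin_zero ql).
  by move=> E1 E2; rewrite fl ql E1 E2.
- move=> [p0 a0] [p1 a1] [/= pp0 pa0] [/= pp1 pa1]; rewrite /E /= (lin_add fl) (lin_add ql).
  have f0 := hom_par f_hom pp0; have f1 := hom_par f_hom pp1.
  have bE t : b' (+) (b (+) b' (+) t) = b (+) t by case: (b); case: (b'); case: t.
  have q0 := hom_par q_hom pa0; have q1 := hom_par q_hom pa1; rewrite !bE in q0 q1.
  case: (b) f0 f1 q0 q1 => /= f0 f1 q0 q1.
    by rewrite addrC [X in _ = X]addrC => /(grading_uniq (mpar_grading B) f1 f0 q1 q0)[].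
  by move=> /(grading_uniq (mpar_grading B) f0 f1 q0 q1)[].
- move=> a r [p w]; rewrite /E /= => Epw.
  rewrite (hom_act f_hom) Epw (act_hom q_hom) -(lin_scale ql).
  transitivity (q (act (W := A') a r w)) => //; rewrite act_shift scalerA.
  congr (q (_ *: _)); rewrite /sgnp.
  by case: (b); case: (b'); case: (gl11_par a); rewrite /= ?expr0 ?expr1; ring.
Qed.

Let E_nonzero : nonzero_on rho E.
Proof.
have [p _ np] := lc_nonzero P_cover; have [a qa] := q_surj (f p).
by exists ((p, a) : X); rewrite /E /= ?qa.
Qed.

Lemma lift_exists : exists g : P -> A, hom_of_parity (b (+) b') g /\ forall x, f x = q (g x).
Proof.
have aX : admissible X.
  by apply: admissible_prod; [exact: lc_adm P_cover|exact: admissible_shift].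
(* A local cover Z inside the fibre product E is the graph of the lift. *)
have [Z ZE lZ] := local_cover_in k_neq0 S_gr S_irr aX rho_hom E_submodule E_nonzero.
have sZ := lc_sub lZ; have Zsub := sub_space sZ.
(* The projection of [Z] to P is a submodule not killed by [pi], hence everything by locality of
   P. *)
have Z_onto p : exists a, Z (p, a).
  have [[u a] Zu nu] := lc_nonzero lZ.
  have [|[p' a'] Zp /= <-] := cover_full (submodule_image fst_hom sZ) _ p; last by exists a'.
  by exists u => //; exists (u, a).
(* Otherwise 0 and the preimages of a maximal chain of P form a longer chain in Z. *)
have Z_inj a : Z (0, a) -> a = 0.
  move=> Za; apply: contrapT => a0; have [U [sU stU]] := P_chain.
  have : (n.+1 <= n)%N; last by rewrite ltnn.
  apply: n_max; exists X, Z, rho; split=> //.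
  exists (fun i => if i is j.+1 then Z `&` [set z | U j z.1] else [set 0]).
  split=> [[|i] iN|[|i] iN].
  - by split; [exact: submodule_zero|move=> _ ->; apply: sub0 Zsub].
  - split; last by move=> z [].
    have [s _] := sU i iN; apply: submoduleI => //; exact: (submodule_preim fst_hom s).
  - have [s _] := sU 0%N isT; split.
      by move=> _ ->; split; [apply: sub0 Zsub|apply: sub0 (sub_space s)].
    move=> /(_ (0, a)) H; apply: a0.
    have [] // : (0, a) = 0 :> X by apply: H; split=> //=; apply: sub0 (sub_space s).
  - have [s1 s2] := stU i iN; split; first by move=> z [Zz Uz]; split=> //; apply: s1.
    move=> H; apply: s2 => p Up; have [w Zw] := Z_onto p.
    by have [] := H (p, w) (conj Zw Up).
have Z_uniq p a a' : Z (p, a) -> Z (p, a') -> a = a'.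
  move=> Z1 Z2; apply/eqP; rewrite -subr_eq0; apply/eqP; apply: Z_inj.
  by have := subB Zsub Z1 Z2; congr Z; congr pair; rewrite /= subrr.
(* [g] is chosen pointwise; its linearity, parity and compatibility with modes follow from [Z_uniq],
   since [Z] is a graded submodule. *)
pose g p : A := sval (cid (Z_onto p)).
have Zg p : Z (p, g p) by exact: svalP (cid (Z_onto p)).
exists g; split=> [|p]; last exact: (ZE _ (Zg p)).
split.
- move=> c x y; apply: (Z_uniq (c *: x + y)); first exact: Zg.
  exact: Zsub.2 c _ _ (Zg x) (Zg y).
- move=> r p pr.
  have GA := mpar_grading A'.
  (* The homogeneous components of [(p, g p)]. Both lie in [Z], and the one of parity [r] has first
     entry [p], so its second entry must be [g p]. *)
  pose pc (t : bool) : X := (if t == r then p else 0, component GA (g p) t).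
  have pcp t : mpar t (pc t).
    split; last exact: component_par.
    rewrite /pc /=; case: eqP => [->//|_]; apply: sub0; exact: par_subspace (mpar_grading P) _.
  have Epc : (p, g p) = pc false + pc true.
    rewrite /pc; case: (r); congr pair; rewrite /= ?addr0 ?add0r //; exact: componentE.
  have Zr : Z (pc r).
    have [|z0 z1] := sub_graded sZ (pcp false) (pcp true); first by rewrite -Epc; apply: Zg.
    by case: (r).
  have -> : g p = component GA (g p) r.
    by apply: (Z_uniq p); [exact: Zg|rewrite /pc eqxx in Zr].
  exact: (component_par GA).
- move=> r v m p pv.
  apply: (Z_uniq (mY v m p)); first exact: Zg.
  have := sub_stable sZ v m (Zg p); congr Z; congr pair.
  by rewrite /= /shift_Y (parity_twist_homog _ pv) (lin_scale (mY_linl _ _)).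
Qed.

End Lifting.

Lemma cover_projective : projective (@Okfin _ k V) P.
Proof.
split; first exact: cover_Okfin.
move=> A B q f [_ grA sNA sEA] _ [[b' hq] sq] [b hf].
have aA : admissible A by split.
have [g [hg Eg]] := lift_exists aA hq sq hf.
by exists g; split=> //; exists (b (+) b').
Qed.

Lemma cover_projective_cover : projective_cover (@Okfin _ k V) pi.
Proof.
have surj_pi : surjection pi by split; [exists false|exact: cover_surjective].
split=> //; first exact: cover_projective.
move=> Q q [OQ liftQ] [hq sq].
have [g [hg Eg]] := liftQ P S pi q cover_Okfin (irreducible_Okfin k_neq0 S_gr S_irr) surj_pi hq.
exists g; split=> //; split=> // p.
have [b hgb] := hg.
have [|x _ <-] := cover_full (submodule_image hgb (submodule_full Q)) _ p; last by exists x.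
have [[s s0] _] := S_irr; have [x qx] := sq s.
by exists (g x); [exists x|rewrite -Eg qx].
Qed.

End Maximal.

(** The longest local cover comes as a submodule of some ambient [W]; passing to the module it
    carries preserves its chain and its locality. *)
Lemma projective_cover_exists : exists (P : vmodule V) (pi : P -> S),
  projective_cover (@Okfin _ k V) pi.
Proof.
have [n [[W [U [rho [lU cU]]]] maxn]] := maximal_local_cover k_neq0 S_gr S_irr.
have sU := lc_sub lU; have ih := incl_hom sU.
pose P := sub_module sU; pose pi (x : P) := rho (incl x).
exists P, pi; apply: (@cover_projective_cover P pi n) => //; last exact: chain_restrict.
split.
- exact: admissible_sub (lc_adm lU).
- exact: comp_even_hom ih (lc_hom lU).
- exact: submodule_full.
- by have [u Uu nu] := lc_nonzero lU; exists (restrict (sub_space sU) Uu).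
- move=> Z sZ _ [z Zz nz] x _.
  have [||] // := lc_local lU (submodule_image ih sZ) _ _ (inclP x).
  + by move=> _ [w _ <-]; apply: inclP.
  + by exists (incl z) => //; exists z.
  + by move=> x' Zx' /incl_inj <-.
Qed.

End ProjectiveCover.

Theorem corollary2p4p7 (R : realType) (k : R[i]) (k_neq0 : k <> 0)
    (V : Vk_gl11 k) (S : vmodule V) :
  grading_restricted S -> irreducible S ->
  exists (P : vmodule V) (pi : P -> S), projective_cover (@Okfin _ k V) pi.
Proof.
by move=> gr irr; apply: projective_cover_exists => //; apply/eqP.
Qed.
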